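(* 1. Let $V$ be a Stein manifold, let $X=\mathbb{P}_n\setminus\{[1:0:\cdots:0]\}$ with $n=\dim V>0$, and let $D\subset X$ be a discrete subset. Then there exists a non-degenerate holomorphic mapping $F:V\to X\setminus D$, and $X\setminus D$ is not measure hyperbolic. 2. Let $D$ be a discrete subset of $X=\mathbb{C}\times\mathbb{P}_1$. Then there exists a non-trivial automorphism $\phi$ of $X$ with $\phi|_D=\mathrm{id}_D$.
   Context: $\mathbb{P}_n$ is complex projective $n$-space. A discrete subset of $X$ means a subset that is closed and discrete in $X$. Automorphisms are biholomorphic self-maps. A holomorphic map between complex manifolds of the same dimension is non-degenerate if it has maximal rank at some point. For an $n$-dimensional complex manifold $M$, the Kobayashi–Eisenman pseudovolume $\mu_M$ at $p\in M$ is the infimum of the volume elements at $p$ obtained by pushing forward by $df_0$ the euclidean volume element at $0$ (up to a fixed normalizing constant), over all holomorphic maps $f:\mathbb{B}_n\to M$ from the unit ball of $\mathbb{C}^n$ with $f(0)=p$ and $df_0$ invertible. $M$ is measure hyperbolic if this pseudovolume is a volume, i.e. $\mu_M(p)>0$ for all $p\in M$.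
   Formalization: Part 1 is proved for n = dim V ≥ 2 and V nonempty instead of n > 0: for n = 1, X = C, and V = C, D = {0,1} refute both conclusions by Picard's theorem. *)

(* Defs.v *)
From HB Require Import structures.
From mathcomp Require Import all_boot all_order all_algebra.
From mathcomp Require Import all_classical all_reals all_analysis.
From mathcomp Require Import complex.

Set Implicit Arguments.
Unset Strict Implicit.
Unset Printing Implicit Defensive.

Import Order.TTheory GRing.Theory Num.Theory.
Import numFieldNormedType.Exports.

Local Open Scope classical_set_scope.
Local Open Scope complex_scope.
Local Open Scope ring_scope.

Section row_vectors.
Variable K : numFieldType.

Lemma cvg_rV (T : topologicalType) n (f : T -> 'rV[K]_n) (x : T) :
  (forall j, {for x, continuous (fun y => f y 0 j : K)}) ->
  {for x, continuous f}.
Proof.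
move=> cf A [P fP sPA]; rewrite /= nbhs_filterE.
have H : \forall y \near x, forall j, P 0 j (f y 0 j).
  by apply: filter_forall => j; exact: (cf j _ (fP 0 j)).
by apply: filterS H => y Py; apply: sPA => i j; rewrite ord1.
Qed.

Lemma differentiable_rV (V : normedModType K) n (f : V -> 'rV[K]_n) (x : V) :
  (forall j, differentiable (fun y => f y 0 j : K^o) x) -> differentiable f x.
Proof.
move=> df.
have -> : f = \sum_(j < n) (fun y => (f y 0 j : K^o) *: delta_mx 0 j).
  apply/funext => y; rewrite fct_sumE; exact: row_sum_delta.
by apply: differentiable_sum => j; exact: differentiableZl.
Qed.

End row_vectors.

Section differentiable_germ.
Variables (K : numFieldType) (V W : normedModType K).

Lemma near0_differentiable (h : V -> W) (x : V) :
  (\forall y \near x, h y = 0) -> differentiable h x.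
Proof.
move=> h0; apply/diffP.
apply: (@getPex _ (fun (df : {linear V -> W}) => continuous df /\
  forall y, h y = h (lim (nbhs x)) + df (y - lim (nbhs x))
                  +o_(y \near x) (y - lim (nbhs x)))).
exists (\0 : {linear V -> W}); split; first exact: cst_continuous.
have hx : h x = 0 by exact: nbhs_singleton h0.
have H : h = (fun y => h (lim (nbhs x)) + \0 (y - lim (nbhs x)))
             +o_x (center (lim (nbhs x))).
  apply/eqaddoP => _/posnumP[e]; rewrite lim_id //.
  apply: filterS h0 => y hy /=.
  by rewrite /= !fctE hy hx /= addr0 subr0 normr0 mulr_ge0.
by move=> y; rewrite {1}H.
Qed.

Lemma near_eq_differentiable (f g : V -> W) (x : V) :
  {near x, f =1 g} -> differentiable f x -> differentiable g x.
Proof.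
move=> fg df; have -> : g = f + (g - f) by rewrite addrC subrK.
apply: differentiableD => //; apply: near0_differentiable.
by apply: filterS fg => y; rewrite !fctE => ->; rewrite subrr.
Qed.

Lemma differentiable_id (x : V) : differentiable (@id V) x.
Proof. by apply: (@linear_differentiable _ _ _ idfun) => y; exact: cvg_id. Qed.

End differentiable_germ.

Lemma continuous_cluster (T U : topologicalType) (f : T -> U) (p q : T) :
  hausdorff_space U -> {for p, continuous f} -> {for q, continuous f} ->
  cluster (nbhs p) q -> f p = f q.
Proof.
move=> hU fp fq pq; apply: hU => A B Ap Bq.
by have [x [Ax Bx]] := pq _ _ (fp _ Ap) (fq _ Bq); exists (f x).
Qed.

Lemma quotient_for_continuous (T U : topologicalType) (Q0 : quotType T)
    (f : quotient_topology Q0 -> U) (D : set (quotient_topology Q0)) :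
  open D ->
  (forall u, D (\pi_(quotient_topology Q0) u)%qT ->
    {for u, continuous (f \o \pi_(quotient_topology Q0)%qT)}) ->
  forall p, D p -> {for p, continuous f}.
Proof.
move=> oD cf p Dp A fpA.
pose O := [set q | D q /\ A° (f q)].
have OA : O `<=` f @^-1` A by move=> q [_ /interior_subset].
apply: filterS OA _; apply: open_nbhs_nbhs; split; last first.
  by split => //; exact: nbhs_interior.
rewrite /open /= /quotient_open openE => u [Du Au].
have Du' : \forall v \near u, D (\pi_(quotient_topology Q0) v)%qT.
  by apply: (@pi_continuous T Q0 u); exact: open_nbhs_nbhs.
have Au' : \forall v \near u, A° (f (\pi_(quotient_topology Q0) v)%qT).
  by apply: (cf u Du); exact: nbhs_interior.
by apply: filterS2 Du' Au' => v; split.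
Qed.

(* [R[i]] seen as a normed field, so that the library's topology on
   [numFieldType]s applies to it and to the matrices over it. *)
Definition Cfield (R : realType) : numFieldType := R[i].

Section manifolds.
Variable R : realType.
Local Notation C := (Cfield R).

Record chart (M : topologicalType) (n : nat) := Chart {
  cdom : set M ;
  cmap : M -> 'rV[C]_n ;
  cinv : 'rV[C]_n -> M ;
  cdom_open : open cdom ;
  crng_open : open (cmap @` cdom) ;
  cmapK : forall p, cdom p -> cinv (cmap p) = p ;
  cmap_continuous : forall p, cdom p -> {for p, continuous cmap} ;
  cinv_continuous : forall p, cdom p -> {for cmap p, continuous cinv} }.

(* [differentiable] over the field [R[i]] is complex differentiability, so the
   last field says that the changes of charts are holomorphic. *)
Record complexManifold (n : nat) := ComplexManifold {
  mcarrier :> topologicalType ;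
  atlas : set (chart mcarrier n) ;
  mhausdorff : hausdorff_space mcarrier ;
  atlas_cover : forall p, exists2 phi, atlas phi & cdom phi p ;
  atlas_holomorphic : forall phi psi, atlas phi -> atlas psi ->
    forall p, cdom phi p -> cdom psi p ->
    differentiable (cmap psi \o cinv phi) (cmap phi p) }.

Definition local_expr m n (M : complexManifold m) (N : complexManifold n)
    (phi : chart M m) (psi : chart N n) (f : M -> N) : 'rV[C]_m -> 'rV[C]_n :=
  cmap psi \o f \o cinv phi.

Definition cdifferentiable_at m n (M : complexManifold m)
    (N : complexManifold n) (f : M -> N) (p : M) :=
  {for p, continuous f} /\
  forall phi psi, atlas phi -> atlas psi -> cdom phi p -> cdom psi (f p) ->
    differentiable (local_expr phi psi f) (cmap phi p).

(* To be used on open sets [W], where holomorphic means complex differentiable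
   at every point. *)
Definition holomorphic_on m n (M : complexManifold m) (N : complexManifold n)
    (W : set M) (f : M -> N) :=
  forall p, W p -> cdifferentiable_at f p.

Definition holomorphic m n (M : complexManifold m) (N : complexManifold n)
    (f : M -> N) :=
  holomorphic_on setT f.

Definition max_rank_at n (M N : complexManifold n) (f : M -> N) (p : M) :=
  exists phi psi, [/\ atlas phi, atlas psi, cdom phi p, cdom psi (f p) &
    \rank ('J (local_expr phi psi f) (cmap phi p)) = n].

Definition nondegenerate_map n (M N : complexManifold n) (f : M -> N) :=
  exists p, max_rank_at f p.

Definition automorphism n (M : complexManifold n) (f : M -> M) :=
  exists g : M -> M,
    [/\ cancel f g, cancel g f, holomorphic f & holomorphic g].

Section affine_space.
Variable n : nat.

Program Definition id_chart : chart 'rV[C]_n n :=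
  @Chart _ _ setT id id openT _ _ _ _.
Next Obligation. by rewrite image_id; exact: openT. Qed.
Next Obligation. by []. Qed.
Next Obligation. by move=> p _; exact: cvg_id. Qed.
Next Obligation. by move=> p _; exact: cvg_id. Qed.

Program Definition affine_space : complexManifold n :=
  @ComplexManifold n 'rV[C]_n [set id_chart] _ _ _.
Next Obligation. exact: norm_hausdorff. Qed.
Next Obligation. by move=> p; exists id_chart. Qed.
Next Obligation. by move=> _ _ -> -> p _ _; exact: differentiable_id. Qed.

End affine_space.

Section complex_line.

Program Definition complex_line_chart : chart C 1 :=
  @Chart C 1 setT (fun z => const_mx z) (fun v => v 0 0) openT _ _ _ _.
Next Obligation.
suff -> : (fun z : C => const_mx z : 'rV[C]_1) @` setT = setT by exact: openT.
apply/seteqP; split => // v _; exists (v 0 0) => //.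
by apply/rowP => j; rewrite mxE ord1.
Qed.
Next Obligation. by move=> p _; rewrite /= mxE. Qed.
Next Obligation.
move=> p _; apply: cvg_rV => j.
suff -> : (fun y : C => (const_mx y : 'rV[C]_1) 0 j) = id by exact: cvg_id.
by apply/funext => y; rewrite mxE.
Qed.
Next Obligation. by move=> p _; exact: coord_continuous. Qed.

Program Definition complex_line : complexManifold 1 :=
  @ComplexManifold 1 C [set complex_line_chart] _ _ _.
Next Obligation. exact: (@norm_hausdorff _ (C^o)). Qed.
Next Obligation. by move=> p; exists complex_line_chart. Qed.
Next Obligation.
move=> _ _ -> -> p _ _.
suff -> : cmap complex_line_chart \o cinv complex_line_chart = id.
  exact: differentiable_id.
by apply/funext => v; apply/rowP => j; rewrite mxE ord1.
Qed.

End complex_line.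

Section product.
Variables (m n : nat) (M : complexManifold m) (N : complexManifold n).

Section prod_chart.
Variables (phi : chart M m) (psi : chart N n).

Definition prod_cmap (p : M * N) : 'rV[C]_(m + n) := row_mx (cmap phi p.1) (cmap psi p.2).
Definition prod_cinv (v : 'rV[C]_(m + n)) : M * N :=
  (cinv phi (lsubmx v), cinv psi (rsubmx v)).

Program Definition prod_chart : chart (M * N)%type (m + n) :=
  @Chart _ _ (cdom phi `*` cdom psi) prod_cmap prod_cinv _ _ _ _ _.
Next Obligation.
rewrite openE => -[p q] [/= php psq]; exists (cdom phi, cdom psi) => //.
by split; apply: open_nbhs_nbhs; split => //; exact: cdom_open.
Qed.
Next Obligation.
suff -> : prod_cmap @` (cdom phi `*` cdom psi) =
    (lsubmx @^-1` (cmap phi @` cdom phi)) `&`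
    (rsubmx @^-1` (cmap psi @` cdom psi)).
  apply: openI; apply: open_comp; try exact: crng_open.
    by move=> v _; exact: continuous_lsubmx.
  by move=> v _; exact: continuous_rsubmx.
apply/seteqP; split => [_ [[p q] [/= php psq] <-]|v [[p php pv] [q psq qv]]].
  by split; rewrite /prod_cmap /= ?row_mxKl ?row_mxKr; [exists p|exists q].
by exists (p, q) => //; rewrite /prod_cmap /= pv qv hsubmxK.
Qed.
Next Obligation.
by move=> [p q] [/= php psq]; rewrite /prod_cinv /prod_cmap row_mxKl row_mxKr !cmapK.
Qed.
Next Obligation.
move=> [p q] [/= php psq]; apply: cvg_rV => j.
case: (split_ordP j) => k ->.
  suff -> : (fun y => prod_cmap y 0 (lshift n k)) =
      (fun v : 'rV[C]_m => v 0 k : C) \o (cmap phi \o fst).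
    apply: continuous_comp; last exact: coord_continuous.
    apply: continuous_comp; first exact: cvg_fst.
    exact: cmap_continuous.
  by apply/funext => y; rewrite /prod_cmap row_mxEl.
suff -> : (fun y => prod_cmap y 0 (rshift m k)) =
    (fun v : 'rV[C]_n => v 0 k : C) \o (cmap psi \o snd).
  apply: continuous_comp; last exact: coord_continuous.
  apply: continuous_comp; first exact: cvg_snd.
  exact: cmap_continuous.
by apply/funext => y; rewrite /prod_cmap row_mxEr.
Qed.
Next Obligation.
move=> [p q] [/= php psq].
have cl : {for prod_cmap (p, q), continuous (cinv phi \o lsubmx)}.
  apply: continuous_comp; first exact: continuous_lsubmx.
  by rewrite /prod_cmap row_mxKl; exact: cinv_continuous.
have cr : {for prod_cmap (p, q), continuous (cinv psi \o rsubmx)}.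
  apply: continuous_comp; first exact: continuous_rsubmx.
  by rewrite /prod_cmap row_mxKr; exact: cinv_continuous.
exact: (cvg_pair cl cr).
Qed.

End prod_chart.

Program Definition prod_manifold : complexManifold (m + n) :=
  @ComplexManifold (m + n) (M * N)%type
    [set prod_chart phi psi | phi in @atlas m M & psi in @atlas n N] _ _ _.
Next Obligation.
move=> [p q] [p' q'] pq; congr (_, _).
  apply: (continuous_cluster (f := fst)) pq; first exact: mhausdorff.
    exact: cvg_fst.
  exact: cvg_fst.
apply: (continuous_cluster (f := snd)) pq; first exact: mhausdorff.
  exact: cvg_snd.
exact: cvg_snd.
Qed.
Next Obligation.
move=> [p q]; have [phi aphi php] := atlas_cover p.
have [psi apsi psq] := atlas_cover q.
by exists (prod_chart phi psi) => //; exists phi => //; exists psi.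
Qed.
Next Obligation.
move=> _ _ [phi aphi [psi apsi <-]] [phi' aphi' [psi' apsi' <-]] [p q].
move=> [/= php psq] [/= php' psq']; apply: differentiable_rV => j.
case: (split_ordP j) => k ->.
  rewrite (_ : (fun y => _) = (fun v : 'rV[C]_m => v 0 k : C^o) \o
      ((cmap phi' \o cinv phi) \o lsubmx)); last first.
    by apply/funext => y; rewrite /= row_mxEl.
  apply: differentiable_comp; last exact: differentiable_coord.
  apply: differentiable_comp; first exact: differentiable_lsubmx.
  by rewrite row_mxKl; exact: atlas_holomorphic.
rewrite (_ : (fun y => _) = (fun v : 'rV[C]_n => v 0 k : C^o) \o
    ((cmap psi' \o cinv psi) \o rsubmx)); last first.
  by apply/funext => y; rewrite /= row_mxEr.
apply: differentiable_comp; last exact: differentiable_coord.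
apply: differentiable_comp; first exact: differentiable_rsubmx.
by rewrite row_mxKr; exact: atlas_holomorphic.
Qed.

End product.

Section open_submanifold.
Variables (n : nat) (M : complexManifold n) (U : set M) (oU : open U).

Lemma val_continuous : continuous (val : U -> M).
Proof. exact: initial_continuous. Qed.

(* [p0] only serves as a default value: [cinv phi] may leave [U]. *)
Section sub_chart.
Variables (phi : chart M n) (p0 : U).

Definition sub_cmap (p : U) : 'rV[C]_n := cmap phi (val p).
Definition sub_cinv (v : 'rV[C]_n) : U := insubd p0 (cinv phi v).

Program Definition sub_chart : chart U n :=
  @Chart _ _ (val @^-1` cdom phi) sub_cmap sub_cinv _ _ _ _ _.
Next Obligation. by exists (cdom phi) => //; exact: cdom_open. Qed.
Next Obligation.
rewrite openE => _ [p php <-].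
have rng : nbhs (cmap phi (val p)) (cmap phi @` cdom phi).
  by apply: open_nbhs_nbhs; split; [exact: crng_open|exists (val p)].
have inU : \forall v \near cmap phi (val p), U (cinv phi v).
  apply: cinv_continuous => //; rewrite cmapK //.
  by apply: open_nbhs_nbhs; split => //; exact: set_valP.
rewrite /interior; apply: filterS2 rng inU => v [q phq <-]; rewrite cmapK // => Uq.
by exists (exist _ q (mem_set Uq)).
Qed.
Next Obligation.
by move=> p php; rewrite /sub_cinv /sub_cmap cmapK // valKd.
Qed.
Next Obligation.
move=> p php; apply: (@continuous_comp U M _ val (cmap phi)); first exact: val_continuous.
exact: cmap_continuous.
Qed.
Next Obligation.
move=> p php A [/= B [[W oW <-] /= Wp] BA].
have inU : \forall v \near sub_cmap p, U (cinv phi v).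
  apply: cinv_continuous => //; rewrite cmapK //.
  by apply: open_nbhs_nbhs; split => //; exact: set_valP.
have inW : \forall v \near sub_cmap p, W (cinv phi v).
  apply: cinv_continuous => //; rewrite cmapK //.
  apply: open_nbhs_nbhs; split => //.
  by move: Wp; rewrite /sub_cinv /sub_cmap cmapK // valKd.
apply: filterS2 inU inW => v Uv Wv; apply: BA.
by rewrite /= /sub_cinv set_valE insubdK // inE.
Qed.

End sub_chart.

Program Definition open_submanifold : complexManifold n :=
  @ComplexManifold n U
    [set sub_chart phi p0 | phi in @atlas n M & p0 in [set: U]] _ _ _.
Next Obligation.
move=> p q pq; apply: val_inj.
apply: (@continuous_cluster U M val p q _ _ _ pq); first exact: mhausdorff.
  exact: val_continuous.
exact: val_continuous.
Qed.
Next Obligation.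
move=> p; have [phi aphi php] := atlas_cover (val p).
by exists (sub_chart phi p) => //; exists phi => //; exists p.
Qed.
Next Obligation.
move=> _ _ [phi aphi [p0 _ <-]] [psi apsi [q0 _ <-]] p /= php psp.
apply: (@near_eq_differentiable _ _ _ (cmap psi \o cinv phi)); last first.
  exact: atlas_holomorphic.
have inU : \forall v \near cmap phi (val p), U (cinv phi v).
  apply: cinv_continuous => //; rewrite cmapK //.
  by apply: open_nbhs_nbhs; split => //; exact: set_valP.
by apply: filterS inU => v Uv; rewrite /= /sub_cmap /sub_cinv insubdK // inE.
Qed.

End open_submanifold.

Section projective_space.
Variable n : nat.

Definition nonzero_rV : set 'rV[C]_n.+1 := [set v | v != 0].

Definition same_line (u v : nonzero_rV) : bool :=
  `[< exists2 c : C, c != 0 & val u = c *: val v >].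

Lemma same_line_refl : reflexive same_line.
Proof. by move=> u; apply/asboolP; exists 1; rewrite ?oner_neq0 ?scale1r. Qed.

Lemma same_line_sym : symmetric same_line.
Proof.
suff H u v : same_line u v -> same_line v u by move=> u v; apply/idP/idP; exact: H.
move=> /asboolP[c c0 uv]; apply/asboolP; exists c^-1; rewrite ?invr_eq0//.
by rewrite uv scalerA mulVf// scale1r.
Qed.

Lemma same_line_trans : transitive same_line.
Proof.
move=> v u w /asboolP[c c0 uv] /asboolP[d d0 vw]; apply/asboolP.
by exists (c * d); rewrite ?mulf_neq0// uv vw scalerA.
Qed.

Canonical same_line_equiv :=
  EquivRel same_line same_line_refl same_line_sym same_line_trans.

Definition projective_points :=
  quotient_topology {eq_quot same_line_equiv}%qT.

(* [v_0 : ... : v_n] *)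
Definition proj_point (v : 'rV[C]_n.+1) (v0 : v != 0) : projective_points :=
  (\pi_projective_points (exist _ v (mem_set v0)))%qT.

Local Notation coord p i := (val (repr (p : projective_points)) 0 i).

Definition proj_cdom (i : 'I_n.+1) : set projective_points :=
  [set p | coord p i != 0].

Definition proj_cmap (i : 'I_n.+1) (p : projective_points) : 'rV[C]_n :=
  \row_j (coord p (lift i j) / coord p i).

Definition homog (i : 'I_n.+1) (z : 'rV[C]_n) : 'rV[C]_n.+1 :=
  \row_k (if unlift i k is Some j then z 0 j else 1).

Lemma homog_i i z : homog i z 0 i = 1.
Proof. by rewrite mxE unlift_none. Qed.

Lemma homog_lift i z j : homog i z 0 (lift i j) = z 0 j.
Proof. by rewrite mxE liftK. Qed.

Lemma homog_neq0 i z : homog i z != 0.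
Proof.
apply/eqP => /rowP/(_ i); rewrite homog_i mxE => /eqP.
by rewrite oner_eq0.
Qed.

Definition proj_cinv i z : projective_points := proj_point (homog_neq0 i z).

Lemma repr_proj_point (u : nonzero_rV) : exists2 c : C, c != 0 &
  val (repr (\pi_projective_points u)%qT) = c *: val u.
Proof.
have /eqmodP : (repr (\pi_projective_points u) = u
  %[mod {eq_quot same_line_equiv}])%qT by rewrite reprK.
by move=> /asboolP.
Qed.

Lemma proj_cdomE i (u : nonzero_rV) :
  proj_cdom i (\pi_projective_points u)%qT <-> val u 0 i != 0.
Proof.
have [c c0] := repr_proj_point u; rewrite /proj_cdom /= => ->.
by rewrite mxE mulf_eq0 (negbTE c0).
Qed.

Lemma proj_cmapE i (u : nonzero_rV) : proj_cmap i (\pi_projective_points u)%qT =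
  \row_j (val u 0 (lift i j) / val u 0 i).
Proof.
have [c c0 cu] := repr_proj_point u; apply/rowP => j; rewrite !mxE cu !mxE.
by rewrite -mulf_div divff// mul1r.
Qed.

Lemma nonzero_val_continuous : continuous (val : nonzero_rV -> 'rV[C]_n.+1).
Proof. exact: initial_continuous. Qed.

Lemma nonzero_coord_continuous (i : 'I_n.+1) :
  continuous (fun u : nonzero_rV => val u 0 i : C).
Proof.
move=> u; apply: (@continuous_comp nonzero_rV 'rV[C]_n.+1 C val
  (fun v => v 0 i)); first exact: nonzero_val_continuous.
exact: coord_continuous.
Qed.

Lemma neq0_near (T : topologicalType) (f : T -> C) (x : T) :
  {for x, continuous f} -> f x != 0 -> \forall y \near x, f y != 0.
Proof.
move=> fx fx0; apply: (fx [set z | z != 0]).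
apply: open_nbhs_nbhs; split=> //.
have -> : [set z : C | z != 0] = ~` [set 0].
  by apply/seteqP; split => z /=; move/eqP.
exact/closed_openC/(@accessible_closed_set1 C)/hausdorff_accessible/(@norm_hausdorff _ C^o).
Qed.

Lemma proj_cdom_open i : open (proj_cdom i).
Proof.
rewrite /open /= /quotient_open openE => u /proj_cdomE ui.
by apply: filterS (neq0_near (@nonzero_coord_continuous i u) ui) => v vi; exact/proj_cdomE.
Qed.

Program Definition proj_chart (i : 'I_n.+1) : chart projective_points n :=
  @Chart _ _ (proj_cdom i) (proj_cmap i) (proj_cinv i) (@proj_cdom_open i) _ _ _ _.
Next Obligation.
move=> i; suff -> : proj_cmap i @` proj_cdom i = setT by exact: openT.
apply/seteqP; split => // z _; exists (proj_cinv i z).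
  by apply/proj_cdomE; rewrite /= homog_i oner_neq0.
rewrite /proj_cinv /proj_point proj_cmapE; apply/rowP => j.
by rewrite mxE /= homog_i homog_lift divr1.
Qed.
Next Obligation.
move=> i p pi; rewrite -[RHS]reprK; apply/eqmodP/asboolP => /=.
exists (coord p i)^-1; first by rewrite invr_eq0.
apply/rowP => k; rewrite [RHS]mxE; case: (unliftP i k) => [j|] ->.
  by rewrite homog_lift mxE mulrC.
by rewrite homog_i mulVf.
Qed.
Next Obligation.
move=> i p pi; apply: cvg_rV => j.
apply: quotient_for_continuous pi => [|u /proj_cdomE ui].
  exact: proj_cdom_open.
pose h (v : 'rV[C]_n.+1) : C := v 0 (lift i j) / v 0 i.
have -> : (fun q => proj_cmap i q 0 j) \o (\pi_projective_points)%qT =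
    (h \o val : nonzero_rV -> C).
  by apply/funext => v; rewrite /= proj_cmapE mxE.
apply: (@continuous_comp nonzero_rV 'rV[C]_n.+1 C val h); first exact: nonzero_val_continuous.
pose c k := (@coord_continuous C 1 n.+1 0 k (val u)).
exact: (continuousM (c (lift i j)) (continuousV ui (c i))).
Qed.
Next Obligation.
move=> i p _; set z := proj_cmap i p.
pose g z : nonzero_rV := exist _ (homog i z) (mem_set (homog_neq0 i z)).
have cg : continuous g.
  apply: (@continuous_comp_initial nonzero_rV 'rV[C]_n _ val) => y.
  apply: cvg_rV => k; case: (unliftP i k) => [j|] ->.
    have -> : (fun y => (val \o g) y 0 (lift i j)) = (fun y => y 0 j : C).
      by apply/funext => y'; rewrite /= homog_lift.
    exact: coord_continuous.
  have -> : (fun y => (val \o g) y 0 i) = (fun=> 1 : C).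
    by apply/funext => y'; rewrite /= homog_i.
  exact: cst_continuous.
apply: (@continuous_comp _ _ _ g (\pi_projective_points)%qT); first exact: cg.
exact: pi_continuous.
Qed.

Lemma proj_separated (p q : projective_points) (i j : 'I_n.+1) :
  cluster (nbhs p) q -> coord p j * coord q i = coord p i * coord q j.
Proof.
move=> pq.
pose l (v : 'rV[C]_n.+1) : C := coord p j * v 0 i - coord p i * v 0 j.
pose g (u : nonzero_rV) : C := `|l (val u)| / `|val u|.
have u0 (u : nonzero_rV) : `|val u| != 0 by rewrite normr_eq0; case: u => v /= /set_mem.
have cg : continuous g.
  move=> u; apply: (@continuous_comp nonzero_rV 'rV[C]_n.+1 C val
    (fun v => `|l v| / `|v|)); first exact: nonzero_val_continuous.
  pose c a k : {for val u, continuous (fun v : 'rV[C]_n.+1 => a * v 0 k : C)} :=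
    continuousM (@cst_continuous _ _ a _) (@coord_continuous C 1 n.+1 0 k _).
  pose cl : {for val u, continuous (l : _ -> C^o)} := continuousB (c _ i) (c _ j).
  have cnl : {for val u, continuous (fun v => `|l v|)}.
    exact: (continuous_comp cl (@norm_continuous _ C^o _)).
  exact: (continuousM cnl (continuousV (u0 u) (@norm_continuous _ _ _))).
have gE u v : same_line u v -> g u = g v.
  move=> /asboolP[c c0 uv]; rewrite /g uv /l !mxE.
  rewrite !(mulrCA _ c) -mulrBr normrM normrZ -mulf_div divff ?mul1r//.
  by rewrite normr_eq0.
have cgr : continuous (g \o repr : projective_points -> C).
  apply: repr_comp_continuous => // u v /eqP/eqmodP uv.
  by apply/eqP; exact: gE.
have := continuous_cluster (@norm_hausdorff _ C^o) (@cgr p) (@cgr q) pq.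
have lp : l (val (repr p)) = 0 by rewrite /l mulrC subrr.
rewrite /= {1}/g lp normr0 mul0r => /esym/eqP.
rewrite /g mulf_eq0 invr_eq0 (negbTE (u0 _)) orbF normr_eq0 subr_eq0.
by move=> /eqP.
Qed.

Lemma proj_cover (p : projective_points) : exists i, proj_cdom i p.
Proof.
have : val (repr p) != 0 by case: (repr p) => v /= /set_mem.
by move=> /rV0Pn[i pi]; exists i.
Qed.

Program Definition projective_space : complexManifold n :=
  @ComplexManifold n projective_points (range proj_chart) _ _ _.
Next Obligation.
move=> p q pq; have [i qi] := proj_cover q.
rewrite -[p]reprK -[q]reprK; apply/eqmodP/asboolP.
have E j : coord p j = coord p i / coord q i * coord q j.
  by apply: (mulIf qi); rewrite (proj_separated i j pq) mulrAC divfK.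
exists (coord p i / coord q i); last by apply/rowP => j; rewrite mxE.
apply/negP => /eqP c0; have [j] := proj_cover p.
by rewrite /proj_cdom /= E c0 mul0r eqxx.
Qed.
Next Obligation.
by move=> p; have [i pi] := proj_cover p; exists (proj_chart i).
Qed.
Next Obligation.
move=> _ _ [i _ <-] [k _ <-] p pi pk; apply: differentiable_rV => j.
have homogD l z : differentiable (fun y : 'rV[C]_n => homog i y 0 l : C^o) z.
  case: (unliftP i l) => [l'|] ->.
    have -> : (fun y => homog i y 0 (lift i l')) = (fun y => y 0 l').
      by apply/funext => y; rewrite homog_lift.
    exact: differentiable_coord.
  have -> : (fun y => homog i y 0 i) = (fun=> 1).
    by apply/funext => y; rewrite homog_i.
  exact: differentiable_cst.
rewrite (_ : (fun y => _) = (fun y => homog i y 0 (lift k j) : C^o) *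
    (fun y => (homog i y 0 k)^-1 : C^o)); last first.
  by apply/funext => y; rewrite /= /proj_cinv /proj_point proj_cmapE mxE.
apply: differentiableM; first exact: homogD.
apply: differentiableV; first exact: homogD.
have /proj_cdomE : proj_cdom k (proj_cinv i (proj_cmap i p)).
  by rewrite (cmapK pi : proj_cinv i (proj_cmap i p) = p).
by [].
Qed.

End projective_space.

Section punctured_projective_space.
Variable n : nat.

Lemma delta0_neq0 : delta_mx 0 0 != 0 :> 'rV[C]_n.+1.
Proof.
by apply/eqP => /rowP/(_ 0)/eqP; rewrite !mxE eqxx /= oner_eq0.
Qed.

(* [1 : 0 : ... : 0] *)
Definition base_point : projective_space n := proj_point delta0_neq0.

Lemma base_pointC_open : open (~` [set base_point]).
Proof.
exact/closed_openC/accessible_closed_set1/hausdorff_accessible/mhausdorff.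
Qed.

Definition punctured_projective_space : complexManifold n :=
  open_submanifold base_pointC_open.

End punctured_projective_space.

Section stein.
Variables (n : nat) (V : complexManifold n).

(* The bound is the supremum of [`|f|] over [K] when [K] is nonempty; the hull
   of [set0] is [set0]. *)
Definition holomorphic_hull (K : set V) : set V :=
  [set p | forall f : V -> complex_line, holomorphic f ->
     forall r : C, (forall q, K q -> `|f q : C| <= r) -> `|f p : C| <= r].

(* Stein manifolds as in Hormander, An Introduction to Complex Analysis in
   Several Variables, Definition 5.1.3; connectedness is not required. *)
Record Stein : Prop := {
  stein_countable_at_infinity : exists K : nat -> set V,
    (forall i, compact (K i)) /\ \bigcup_i K i = setT ;
  stein_holomorphically_convex : forall K : set V,
    compact K -> compact (holomorphic_hull K) ;
  stein_separated : forall p q : V, p <> q ->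
    exists2 f : V -> complex_line, holomorphic f & f p <> f q ;
  stein_coordinates : forall p : V,
    exists2 f : V -> affine_space n, holomorphic f & max_rank_at f p }.

End stein.

Section measure_hyperbolicity.
Variables (n : nat) (M : complexManifold n).

Definition unit_ball : set (affine_space n) :=
  [set z : 'rV[C]_n | \sum_(i < n) `|z 0 i| ^+ 2 < 1].

(* The density at [p], in the chart [psi], of the Kobayashi-Eisenman
   pseudovolume. A linear map [A] of C^n has real determinant [|det A|^2], so
   it pushes the euclidean volume element forward to [|det A|^-2] times itself.
   Another chart at [p] multiplies the density by a positive factor. *)
Definition pseudovolume (psi : chart M n) (p : M) : \bar R :=
  ereal_inf
    [set ((Normc.normc (\det ('J (cmap psi \o f) 0)) ^- 2)%R)%:E |
      f in [set f : affine_space n -> M |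
        [/\ holomorphic_on unit_ball f, f (0 : 'rV[C]_n) = p &
            'J (cmap psi \o f) 0 \in unitmx]]].

Definition measure_hyperbolic :=
  forall (p : M) (psi : chart M n), atlas psi -> cdom psi p ->
    (0 < pseudovolume psi p)%E.

End measure_hyperbolicity.

End manifolds.

(* Main.v *)
Require Import Defs.
From HB Require Import structures.
From mathcomp Require Import all_boot all_order all_algebra.
From mathcomp Require Import all_classical all_reals all_analysis.
From mathcomp Require Import complex ring lra.

Set Implicit Arguments.
Unset Strict Implicit.
Unset Printing Implicit Defensive.

Import Order.TTheory GRing.Theory Num.Theory.
Import numFieldNormedType.Exports.

Local Open Scope classical_set_scope.
Local Open Scope complex_scope.
Local Open Scope ring_scope.

Local Notation normc := Normc.normc.

(** Everything rests on one function: given a closed discrete set T of complex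
numbers and a point c outside T, there is an entire function h with h(c) = 1
that vanishes on T ([entire_vanishing_at]). After a translation c is 0, and h is
a limit of polynomials. To pass from the k-th to the next, multiply it by
1 - (z/a)^m for each of the finitely many a in T with k < |a| <= k + 1; for large
m this changes the polynomial very little on the disc of radius k, keeps its
value at 0, and creates a zero at a. The changes are measured by the sum of the
moduli of the coefficients, weighted by powers of the radius ([majorant]), which
bounds the values, the derivative and the remainder of order two. So the limit
is complex differentiable by a direct estimate, without any integral formula.

In the punctured projective space, the set of the points with
|z_0| <= r max(|z_1|, ..., |z_n|) is compact, hence meets D in a finite set. So
in the chart z_1 <> 0, with coordinates t = z_0/z_1 and w_j = z_j/z_1, only
finitely many points of D have |t| <= r: the projection t is finite-to-one from
D onto a closed discrete set T, and D is countable in this chart. Choose a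
number c that is not a coordinate of any point of D in the chart, and h as
above. The map

  G(s_0, s_1, s_2, ...) = (c + s_0, c + h(c + s_0) s_1, s_2, ...)

misses D: where t is in T, the coordinate w_2 is equal to c, and where t is not
in T there is no point of D. Its differential at 0 is the identity
([dominating_map]). If g is a map from V to affine space of maximal rank at p,
which exists because V is Stein, then G(g - g(p)) is holomorphic and
nondegenerate at p. The maps s |-> G(k s) of the unit ball have differential k
at 0, so the pseudovolume vanishes at G(0).

In C x P_1 the projective line is compact, so D projects onto a closed discrete
subset of C. With h vanishing on that subset and h(c) = 1, the map
(t, [u : v]) |-> (t, [u + h(t) v : v]) fixes D pointwise, moves the point
(c, [0 : 1]), and has as its inverse the same map for - h. *)

(** * The modulus of complex numbers and dyadic sequences *)

Section complex_norm.
Variable R : realType.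
Implicit Types z w : R[i].

Lemma normE z : `|z| = (normc z)%:C.
Proof. by []. Qed.

Lemma normc_ge0 z : 0 <= normc z.
Proof. by rewrite -ler0c -normE normr_ge0. Qed.

Lemma normcX z n : normc (z ^+ n) = normc z ^+ n.
Proof.
elim: n => [|n IH]; first by rewrite !expr0 Normc.normc1.
by rewrite !exprS Normc.normcM IH.
Qed.

Lemma le_normcB z w : normc (z - w) <= normc z + normc w.
Proof. by have := le_normcD z (- w); rewrite normcN. Qed.

Lemma normc_sum (I : Type) (s : seq I) (P : pred I) (F : I -> R[i]) :
  normc (\sum_(i <- s | P i) F i) <= \sum_(i <- s | P i) normc (F i).
Proof.
elim/big_ind2: _ => [|a b c d ab cd|//]; first by rewrite Normc.normc0.
exact: le_trans (le_normcD _ _) (lerD ab cd).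
Qed.

Lemma normc_gt0 z : (0 < normc z) = (z != 0).
Proof.
rewrite lt_def normc_ge0 andbT; congr negb; apply/eqP/eqP => [/Normc.eq0_normc//|->].
exact: Normc.normc0.
Qed.

Lemma normc_le_ReIm z : normc z <= `|complex.Re z| + `|complex.Im z|.
Proof.
rewrite -lecR -normE; case: z => a b /=.
have -> : (a +i* b) = a%:C + 'i * b%:C by rewrite (complexE (a +i* b)).
apply: le_trans (ler_normD _ _) _; rewrite normrM rmorphD/= lerD//.
  by rewrite normc_def /= expr0n addr0 sqrtr_sqr.
rewrite [X in X * _]normc_def /= expr0n expr1n add0r sqrtr1 mul1r.
by rewrite normc_def /= expr0n addr0 sqrtr_sqr.
Qed.

Lemma Re_le_normc z : `|complex.Re z| <= normc z.
Proof. by rewrite -lecR -normE normc_ge_Re. Qed.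

Lemma Im_le_normc z : `|complex.Im z| <= normc z.
Proof.
by case: z => a b /=; rewrite -sqrtr_sqr ler_wsqrtr// lerDr sqr_ge0.
Qed.

Lemma normc_nat n : normc (n%:R : R[i]) = n%:R.
Proof. by apply: complexI; rewrite -normE normr_nat rmorph_nat. Qed.

Lemma exists_natr_ge (x : R) : exists n, x <= n%:R.
Proof.
exists (Num.truncn `|x|).+1; rewrite (le_trans (ler_norm x))// ltW//.
by have /andP[] := truncn_itv (normr_ge0 x).
Qed.

Lemma gt0_real_complex (e : R[i]) : 0 < e -> exists2 d : R, 0 < d & e = d%:C.
Proof.
move=> e0; have ed : e = (complex.Re e)%:C by rewrite RRe_real// gtr0_real.
by exists (complex.Re e); rewrite // -ltcR -ed.
Qed.

(** Telescoping against the geometric series squeezes the sequence between a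
nondecreasing and a nonincreasing one, so that its limit is a supremum and the
rate of convergence comes for free. *)
Lemma dyadic_cvg_real (u : nat -> R) N :
  (forall k, (N <= k)%N -> `|u k.+1 - u k| <= 2^-1 ^+ k) ->
  exists l, forall k, (N <= k)%N -> `|u k - l| <= 2 * 2^-1 ^+ k.
Proof.
move=> uN.
pose a k := u k - 2 * 2^-1 ^+ k; pose b k := u k + 2 * 2^-1 ^+ k.
have a1 k : (N <= k)%N -> a k <= a k.+1.
  by move=> /uN; rewrite /a exprS ler_norml => /andP[]; lra.
have b1 k : (N <= k)%N -> b k.+1 <= b k.
  by move=> /uN; rewrite /b exprS ler_norml => /andP[]; lra.
have am k j : (N <= k)%N -> a k <= a (k + j)%N.
  move=> Nk; elim: j => [|j IH]; first by rewrite addn0.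
  by rewrite addnS (le_trans IH)// a1// (leq_trans Nk)// leq_addr.
have bm k j : (N <= k)%N -> b (k + j)%N <= b k.
  move=> Nk; elim: j => [|j IH]; first by rewrite addn0.
  by rewrite addnS (le_trans _ IH)// b1// (leq_trans Nk)// leq_addr.
have ab j : a j <= b j.
  have : 0 <= 2^-1 ^+ j :> R by rewrite exprn_ge0.
  by rewrite /a /b; lra.
have abm j k : (N <= j)%N -> (N <= k)%N -> a j <= b k.
  move=> Nj Nk; rewrite (le_trans (am j k Nj))// (le_trans _ (bm k j Nk))//.
  by rewrite addnC.
pose A := [set a k | k in [set k | (N <= k)%N]].
have A0 : A !=set0 by exists (a N); exists N => /=.
have Aub k : (N <= k)%N -> ubound A (b k).
  by move=> Nk _ [j /= Nj <-]; exact: abm.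
exists (sup A) => k Nk; have lb : sup A <= b k by apply: ge_sup => //; exact: Aub.
have : a k <= sup A by apply: ub_le_sup; [exists (b k); exact: Aub|exists k].
by move: lb; rewrite /a /b ler_norml => ? ?; apply/andP; split; lra.
Qed.

(** The real and the imaginary part converge separately, which is why the
constant doubles. *)
Lemma dyadic_cvg (u : nat -> R[i]) N :
  (forall k, (N <= k)%N -> normc (u k.+1 - u k) <= 2^-1 ^+ k) ->
  exists l, forall k, (N <= k)%N -> normc (u k - l) <= 4 * 2^-1 ^+ k.
Proof.
move=> uN.
have [k Nk|a ha] := @dyadic_cvg_real (fun k => complex.Re (u k)) N.
  by rewrite -raddfB (le_trans (Re_le_normc _))// uN.
have [k Nk|b hb] := @dyadic_cvg_real (fun k => complex.Im (u k)) N.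
  by rewrite -raddfB (le_trans (Im_le_normc _))// uN.
exists (a +i* b) => k Nk; apply: le_trans (normc_le_ReIm _) _.
have := ha k Nk; have := hb k Nk; case: (u k) => c d /=; lra.
Qed.

End complex_norm.

(** * Majorants of polynomials *)

Section majorant.
Variable R : realType.
Local Notation C := R[i].
Implicit Types (p q : {poly C}) (r : R).

(** A bound for |p| on the disc of radius r that also controls the derivative
and the Taylor remainder on a slightly smaller disc, coefficient by coefficient.
The supremum of |p| would do so only through Cauchy's formula. *)
Definition majorant p r := \sum_(i < size p) normc p`_i * r ^+ i.

Lemma majorant_wide n p r : (size p <= n)%N ->
  majorant p r = \sum_(i < n) normc p`_i * r ^+ i.
Proof.
move=> pn; rewrite /majorant.
rewrite (big_ord_widen n (fun i => normc p`_i * r ^+ i) pn) big_mkcond.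
apply: eq_bigr => i _; case: ifPn => //; rewrite -leqNgt => pi.
by rewrite nth_default// Normc.normc0 mul0r.
Qed.

Lemma majorant_ge0 p r : 0 <= r -> 0 <= majorant p r.
Proof.
by move=> r0; apply: sumr_ge0 => i _; rewrite mulr_ge0 ?normc_ge0 ?exprn_ge0.
Qed.

Lemma majorantD p q r : 0 <= r ->
  majorant (p + q) r <= majorant p r + majorant q r.
Proof.
move=> r0; set n := maxn (size p) (size q).
rewrite (majorant_wide _ (size_polyD _ _)) -/n.
rewrite (@majorant_wide n p) ?leq_maxl// (@majorant_wide n q) ?leq_maxr//.
rewrite -big_split/=; apply: ler_sum => i _.
by rewrite coefD -mulrDl ler_wpM2r ?exprn_ge0// le_normcD.
Qed.

Lemma majorantZXn c n p r : majorant (c *: (p * 'X^n)) r =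
  normc c * r ^+ n * majorant p r.
Proof.
have sz : (size (c *: (p * 'X^n)) <= n + size p)%N.
  apply: leq_trans (size_scale_leq _ _) _.
  by have [->|p0] := eqVneq p 0; rewrite ?mul0r ?size_poly0// size_mulXn.
rewrite (majorant_wide _ sz) big_split_ord/= big1 ?add0r => [|i _]; last first.
  by rewrite coefZ coefMXn ltn_ord mulr0 Normc.normc0 mul0r.
rewrite /majorant big_distrr/=; apply: eq_bigr => i _.
rewrite coefZ coefMXn ltnNge leq_addr/= addKn Normc.normcM exprD.
by rewrite mulrACA -!mulrA mulrCA; congr (_ * _); rewrite mulrCA.
Qed.

Lemma le_majorant p r s : 0 <= r -> r <= s -> majorant p r <= majorant p s.
Proof.
move=> r0 rs; apply: ler_sum => i _.
by rewrite ler_wpM2l ?normc_ge0// lerXn2r ?nnegrE ?(le_trans r0).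
Qed.

Lemma normc_horner p r z : normc z <= r -> normc p.[z] <= majorant p r.
Proof.
move=> zr; rewrite horner_coef; apply: le_trans (normc_sum _ _ _) _.
apply: ler_sum => i _; rewrite Normc.normcM normcX ler_wpM2l ?normc_ge0//.
by rewrite lerXn2r ?nnegrE ?normc_ge0// (le_trans _ zr)// normc_ge0.
Qed.

(** The loss of 2 in the radius pays for the factor i in the derivative of the
i-th power; the same 2 is enough for the remainder of order two below. *)
Lemma natr_expn_le r i : 0 <= r -> i%:R * r ^+ i.-1 <= (r + 2) ^+ i.
Proof.
move=> r0; elim: i => [|i IH]; first by rewrite mul0r expr0.
rewrite /= [in leRHS]exprS; set s := r + 2 in IH *.
have si : r ^+ i <= s ^+ i by rewrite lerXn2r ?nnegrE /s//; lra.
have : r * (i%:R * r ^+ i.-1) <= r * s ^+ i by rewrite ler_wpM2l.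
have -> : r * (i%:R * r ^+ i.-1) = i%:R * r ^+ i.
  by case: i {IH si} => [|i]; rewrite ?mul0r ?mulr0// [in RHS]exprS; ring.
have ri0 : 0 <= r ^+ i by rewrite exprn_ge0.
rewrite -natr1 mulrDl mul1r /s; rewrite -/s => ?.
have : r * s ^+ i + 2 * s ^+ i = s * s ^+ i by rewrite /s; ring.
by move: ri0 si; lra.
Qed.

Lemma deriv_coef p : p^`() = \sum_(i < size p) p`_i *: ('X^(i.-1) *+ i).
Proof.
rewrite -[p in LHS]coefK poly_def linear_sum/=.
by apply: eq_bigr => i _; rewrite linearZ/= derivXn.
Qed.

Lemma horner_deriv_coef p z :
  p^`().[z] = \sum_(i < size p) p`_i * (i%:R * z ^+ i.-1).
Proof.
rewrite deriv_coef horner_sum; apply: eq_bigr => i _.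
by rewrite hornerZ hornerMn hornerXn mulr_natl.
Qed.

Lemma normc_deriv p r z : normc z <= r ->
  normc p^`().[z] <= majorant p (r + 2).
Proof.
move=> zr; have r0 : 0 <= r by apply: le_trans zr; exact: normc_ge0.
rewrite horner_deriv_coef; apply: le_trans (normc_sum _ _ _) _.
apply: ler_sum => i _; rewrite !Normc.normcM normcX ler_wpM2l ?normc_ge0//.
apply: le_trans (natr_expn_le i r0); rewrite normc_nat ler_wpM2l//.
by rewrite lerXn2r ?nnegrE ?normc_ge0.
Qed.

Lemma normc_taylor1_monomial r z u i : normc z <= r -> normc u <= 1 ->
  normc ((z + u) ^+ i - z ^+ i - u * (i%:R * z ^+ i.-1)) <=
  normc u ^+ 2 * (r + 2) ^+ i.
Proof.
move=> zr u1; have r0 : 0 <= r by apply: le_trans zr; exact: normc_ge0.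
elim: i => [|i IH].
  rewrite !expr0 subrr mul0r mulr0 subr0 Normc.normc0 mulr1.
  by rewrite exprn_ge0 ?normc_ge0.
set E := (X in normc X <= normc u ^+ 2 * (r + 2) ^+ i) in IH.
(* E is the remainder for the exponent i. *)
have -> : (z + u) ^+ i.+1 - z ^+ i.+1 - u * (i.+1%:R * z ^+ i.+1.-1) =
    (z + u) * E + u ^+ 2 * (i%:R * z ^+ i.-1).
  rewrite /E -natr1 /=.
  case: i {IH E} => [|i]; first by rewrite !expr0 !expr1; ring.
  by rewrite /= !exprS; ring.
apply: le_trans (le_normcD _ _) _; rewrite !Normc.normcM !normcX normc_nat.
have zu : normc (z + u) <= r + 1 by rewrite (le_trans (le_normcD _ _))// lerD.
have h1 : normc (z + u) * normc E <= (r + 1) * (normc u ^+ 2 * (r + 2) ^+ i).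
  by apply: ler_pM => //; exact: normc_ge0.
have h2 : i%:R * normc z ^+ i.-1 <= (r + 2) ^+ i.
  apply: le_trans (natr_expn_le i r0); rewrite ler_wpM2l//.
  by rewrite lerXn2r ?nnegrE ?normc_ge0.
have h3 : normc u ^+ 2 * (i%:R * normc z ^+ i.-1) <= normc u ^+ 2 * (r + 2) ^+ i.
  by rewrite ler_wpM2l// exprn_ge0// normc_ge0.
apply: le_trans (lerD h1 h3) _; rewrite (exprS (r + 2) i).
by rewrite le_eqVlt; apply/orP; left; apply/eqP; ring.
Qed.

Lemma normc_taylor1 p r z u : normc z <= r -> normc u <= 1 ->
  normc (p.[z + u] - p.[z] - u * p^`().[z]) <=
  normc u ^+ 2 * majorant p (r + 2).
Proof.
move=> zr u1; rewrite horner_deriv_coef !horner_coef big_distrr/= -!sumrB.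
apply: le_trans (normc_sum _ _ _) _.
rewrite /majorant big_distrr/=; apply: ler_sum => i _.
rewrite -mulrBr mulrCA -mulrBr Normc.normcM [leRHS]mulrCA.
by rewrite ler_wpM2l ?normc_ge0// normc_taylor1_monomial.
Qed.

End majorant.

(** * Entire functions vanishing on a closed discrete set *)

Section entire_functions.
Variable R : realType.
Local Notation C := (Cfield R).

Lemma geometric_small (x c e : R) : 0 <= x -> x < 1 -> 0 <= c -> 0 < e ->
  exists m, c * x ^+ m.+1 <= e.
Proof.
move=> x0 x1 c0 e0.
have c1 : 0 < c + 1 by lra.
have xm : `|x| < 1 by rewrite ger0_norm.
have /cvgrPdist_le/(_ (e / (c + 1)))[|N _ NP] := cvg_expr xm.
  by rewrite divr_gt0.
exists N; have := NP N.+1 (leqnSn _).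
rewrite sub0r normrN ger0_norm ?exprn_ge0// ler_pdivlMr// mulrDr mulr1.
by rewrite mulrC; apply: le_trans; rewrite lerDl exprn_ge0.
Qed.

(** Multiplying by 1 - (z/a)^m with m large creates a zero at a, preserves the
other zeros and the value at 0, and changes little where |z| <= r < |a|. *)
Lemma vanish_perturbation (s : seq R[i]) (r e : R) (p : {poly R[i]}) :
  0 <= r -> 0 < e -> (forall a, a \in s -> r < normc a) ->
  exists q : {poly R[i]}, [/\ majorant (q - p) r <= e, q.[0] = p.[0],
    (forall x, root p x -> root q x) & (forall a, a \in s -> root q a)].
Proof.
move=> r0; elim: s e => [|a s IH] e e0 sr.
  exists p; split => //; rewrite subrr /majorant size_poly0 big_ord0.
  exact: ltW.
have [||q [qe q0 pq qs]] := IH (e / 2).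
- by rewrite divr_gt0.
- by move=> b bs; apply: sr; rewrite inE bs orbT.
have ra : r < normc a by apply: sr; rewrite inE eqxx.
have na : 0 < normc a by apply: le_lt_trans ra.
have a0 : a != 0 by rewrite -normc_gt0.
have [||||m mP] := @geometric_small (r / normc a) (majorant q r) (e / 2).
- by rewrite divr_ge0 ?normc_ge0.
- by rewrite ltr_pdivrMr// mul1r.
- exact: majorant_ge0.
- by rewrite divr_gt0.
exists (q + (- (a ^- m.+1)) *: (q * 'X^(m.+1))); split.
- rewrite addrAC [e](_ : _ = e / 2 + e / 2); last by lra.
  apply: le_trans (majorantD _ _ r0) _; apply: lerD => //.
  rewrite majorantZXn normcN Normc.normcV normcX.
  by rewrite mulrC -exprVn -exprMn [_^-1 * _]mulrC.
- by rewrite hornerD hornerZ hornerM hornerXn expr0n /= !mulr0 addr0.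
- move=> x /pq /rootP qx; apply/rootP.
  by rewrite hornerD hornerZ hornerM qx mul0r mulr0 addr0.
- move=> b; rewrite inE => /predU1P[->|/qs/rootP qb]; apply/rootP.
    rewrite hornerD hornerZ hornerM hornerXn mulNr mulrCA mulVf ?mulr1 ?subrr//.
    by rewrite expf_neq0.
  by rewrite hornerD hornerZ hornerM qb mul0r mulr0 addr0.
Qed.

(** The closed discrete subsets of the complex line, in the form in which they
arise from compactness and are used in the construction. *)
Definition locally_finite (T : set R[i]) :=
  forall r : R, finite_set (T `&` [set z | normc z <= r]).

(** At stage k the zeros created are the points of T with k < |t| <= k + 1, and
the perturbation is small on the disc of radius k. *)
Lemma vanishing_polynomials (T : set R[i]) : locally_finite T -> ~ T 0 ->
  exists S : nat -> {poly R[i]}, [/\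
    (forall k, majorant (S k.+1 - S k) k%:R <= 2^-1 ^+ k),
    (forall k, (S k).[0] = 1) &
    (forall t, T t -> exists N, forall k, (N <= k)%N -> (S k).[t] = 0)].
Proof.
move=> lfT T0.
have step (kp : nat * {poly R[i]}) : exists q : {poly R[i]},
    [/\ majorant (q - kp.2) kp.1%:R <= 2^-1 ^+ kp.1, q.[0] = kp.2.[0],
    (forall x, root kp.2 x -> root q x) &
    (forall a, T a -> kp.1%:R < normc a <= kp.1.+1%:R -> root q a)].
  case: kp => k p /=; have /finite_seqP[s sE] := lfT k.+1%:R.
  have [| |a|q [q1 q2 q3 q4]] :=
      @vanish_perturbation [seq a <- s | k%:R < normc a] k%:R (2^-1 ^+ k) p.
  - exact: ler0n.
  - by rewrite exprn_gt0.
  - by rewrite mem_filter => /andP[].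
  exists q; split => // a Ta /andP[ka ak]; apply: q4.
  rewrite mem_filter ka /=.
  by have : (T `&` [set z | normc z <= k.+1%:R]) a by []; rewrite sE.
have [f fP] := choice step.
pose S := fix S k := if k is k'.+1 then f (k', S k') else 1 : {poly R[i]}.
have rootS k j x : root (S k) x -> root (S (k + j)%N) x.
  move=> Sx; elim: j => [|j IH]; first by rewrite addn0.
  rewrite addnS /=.
  by have [_ _ h _] := fP ((k + j)%N, S (k + j)%N); exact: h.
exists S; split=> [k|k|t Tt].
- by have [] := fP (k, S k).
- elim: k => [|k IH]; first by rewrite hornerC.
  by have [_ h _ _] := fP (k, S k); rewrite /= h.
- have t0 : 0 < normc t by rewrite normc_gt0; apply: contra_notN T0 => /eqP <-.
  (* The stage at which t becomes a zero. *)
  have [k kt] : exists k, k%:R < normc t <= k.+1%:R.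
    case: (ex_minnP (exists_natr_ge (normc t))) => -[|n]; first by rewrite leNgt t0.
    move=> tn min; exists n; rewrite tn andbT ltNge; apply/negP => /min.
    by rewrite ltnn.
  exists k.+1 => j kj; apply/rootP; rewrite -(subnKC kj); apply: rootS.
  by have [_ _ _ h] := fP (k, S k); exact: h.
Qed.

(** A quadratic bound on the remainder is what passes to the limit of a sequence
of polynomials. *)
Lemma quadratic_differentiable (h : C^o -> C^o) (z l : C) (B : R) :
  (forall u : C, normc u <= 1 ->
    normc (h (z + u) - h z - u * l) <= normc u ^+ 2 * B) ->
  differentiable h z.
Proof.
move=> hB; apply/derivable1_diffP; apply/cvg_ex; exists l.
apply/cvgrPdist_le => e e0.
have [d d0 de] := gt0_real_complex e0.
have B0 : 0 < `|B| + 1 by rewrite ltr_wpDl.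
pose m : R := Num.min 1 (d / (`|B| + 1)).
have m0 : 0 < m by rewrite lt_min ltr01 divr_gt0.
near=> u.
have u0 : u != 0 by near: u; exact: nbhs_dnbhs_neq.
have um : normc u <= m.
  rewrite -lecR -normE; near: u; apply: dnbhs0_le.
  by rewrite ltcR.
rewrite /= -[e]/e de.
have -> : l - u^-1 *: (h (u *: (1 : C^o) + z) - h z) =
    - (u^-1 * (h (z + u) - h z - u * l)).
  rewrite [u *: _]mulr1 [u + z]addrC [_ *: _]/(u^-1 * (h (z + u) - h z)).
  by rewrite [in RHS]mulrBr (mulKf u0) opprB.
rewrite normrN normE lecR Normc.normcM Normc.normcV.
have nu : 0 < normc u by rewrite normc_gt0.
rewrite mulrC ler_pdivrMr//; apply: le_trans (hB _ _) _.
  by rewrite (le_trans um)// ge_min lexx.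
rewrite expr2 -mulrA mulrC; rewrite ler_wpM2r ?normc_ge0//.
have : normc u <= d / (`|B| + 1) by rewrite (le_trans um)// ge_min lexx orbT.
rewrite ler_pdivlMr// mulrDr => h1.
apply: le_trans h1; rewrite -[leLHS]addr0 lerD ?mulr_ge0 ?normc_ge0//.
by rewrite ler_wpM2l ?normc_ge0// ler_norm.
Unshelve. all: by end_near.
Qed.

(** The corrections add up to at most a geometric series; subtracting its tail
makes the bound inductive. *)
Lemma majorant_partial (S : nat -> {poly R[i]}) (N k : nat) (r : R) :
  (forall k, majorant (S k.+1 - S k) k%:R <= 2^-1 ^+ k) ->
  0 <= r -> r <= N%:R -> (N <= k)%N ->
  majorant (S k) r <= majorant (S N) r + 2 * 2^-1 ^+ N - 2 * 2^-1 ^+ k.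
Proof.
move=> SP r0 rN /subnKC <-; elim: (k - N)%N => [|j IH]; first by rewrite addn0 addrK.
rewrite addnS; set n := (N + j)%N in IH *.
have -> : S n.+1 = S n + (S n.+1 - S n) by rewrite addrC subrK.
apply: le_trans (majorantD _ _ r0) _.
have : majorant (S n.+1 - S n) r <= 2^-1 ^+ n.
  apply: le_trans (SP n); apply: le_majorant => //.
  by rewrite (le_trans rN)// ler_nat leq_addr.
move: IH; rewrite [2^-1 ^+ n.+1]exprS; lra.
Qed.

Lemma le_dyadic_limit (x y c : R) N :
  (forall k, (N <= k)%N -> x <= y + c * 2^-1 ^+ k) -> 0 <= c -> x <= y.
Proof.
move=> xy c0; apply/ler_addgt0Pr => e e0.
have [||||m mP] := @geometric_small 2^-1 (c * 2^-1 ^+ N) e.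
- by rewrite invr_ge0.
- by rewrite invf_lt1// ltr1n.
- by rewrite mulr_ge0// exprn_ge0.
- by [].
apply: le_trans (xy (N + m.+1)%N (leq_addr _ _)) _.
by rewrite lerD2l exprD mulrA.
Qed.

Lemma dyadic_cvg_from (u : nat -> R[i]) (r : R) :
  (forall k, r <= k%:R -> normc (u k.+1 - u k) <= 2^-1 ^+ k) ->
  exists l, forall k, r <= k%:R -> normc (u k - l) <= 4 * 2^-1 ^+ k.
Proof.
move=> ur; have [N rN Nmin] := ex_minnP (exists_natr_ge r).
have [k Nk|l lP] := @dyadic_cvg _ u N.
  by apply: ur; rewrite (le_trans rN)// ler_nat.
by exists l => k /Nmin; exact: lP.
Qed.

(** The limit of the polynomials of [vanishing_polynomials]. Their first-order
Taylor remainders at z are bounded by B |u|^2 with B independent of k, and so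
are those of the limit; the candidate for its derivative is the limit of the
derivatives. *)
Theorem entire_vanishing (T : set R[i]) : locally_finite T -> ~ T 0 ->
  exists h : C -> C, [/\ (forall z, differentiable (h : C^o -> C^o) z),
    h 0 = 1 & forall t, T t -> h t = 0].
Proof.
move=> lfT T0; have [S [SP S0 ST]] := vanishing_polynomials lfT T0.
have /choice[h hP] : forall z : C, exists l : C, forall k, normc z <= k%:R ->
    normc ((S k).[z] - l) <= 4 * 2^-1 ^+ k.
  move=> z; apply: dyadic_cvg_from => k zk.
  by rewrite -hornerN -hornerD (le_trans (normc_horner _ zk)).
have eqh (z l : C) : (exists N, forall k, (N <= k)%N -> (S k).[z] = l) -> h z = l.
  move=> [N SN]; apply/eqP; rewrite -subr_eq0 -oppr_eq0 opprB -[_ == 0]negbK -normc_gt0.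
  rewrite -leNgt; have [M zM] := exists_natr_ge (normc z).
  apply: (@le_dyadic_limit _ _ 4 (maxn N M)) => // k.
  rewrite geq_max add0r => /andP[Nk Mk]; rewrite -(SN k Nk); apply: hP.
  by rewrite (le_trans zM)// ler_nat.
exists h; split=> [z||t Tt].
- have [d dP] : exists d, forall k, normc z + 2 <= k%:R ->
      normc ((S k)^`().[z] - d) <= 4 * 2^-1 ^+ k.
    apply: dyadic_cvg_from => k zk.
    rewrite -hornerN -hornerD -derivN -derivD.
    apply: le_trans (normc_deriv _ (lexx _)) _; apply: le_trans (SP k).
    by rewrite le_majorant ?addr_ge0 ?normc_ge0.
  have [N zN] := exists_natr_ge (normc z + 2).
  have z2 : 0 <= normc z + 2 by rewrite addr_ge0 ?normc_ge0.
  pose B := majorant (S N) (normc z + 2) + 2 * 2^-1 ^+ N.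
  apply: (@quadratic_differentiable h z d B) => u u1.
  (* 12 = 3 * 4: the values at z and z + u and the derivative at z each differ
     from their limit by at most 4 / 2 ^ k. *)
  apply: (@le_dyadic_limit _ _ 12 N) => // k Nk.
  have zk : normc z + 2 <= k%:R by rewrite (le_trans zN)// ler_nat.
  have h1 := dP k zk.
  have h2 : normc ((S k).[z] - h z) <= 4 * 2^-1 ^+ k by apply: hP; lra.
  have h3 : normc ((S k).[z + u] - h (z + u)) <= 4 * 2^-1 ^+ k.
    by apply: hP; have := le_normcD z u; lra.
  have h4 := normc_taylor1 (S k) (lexx (normc z)) u1.
  have h5 := majorant_partial SP z2 zN Nk.
  have e0 : 0 <= 2^-1 ^+ k :> R by rewrite exprn_ge0.
  have h6 : normc u ^+ 2 * majorant (S k) (normc z + 2) <= normc u ^+ 2 * B.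
    by rewrite ler_wpM2l ?exprn_ge0 ?normc_ge0//; move: h5; rewrite -/B; lra.
  have -> : h (z + u) - h z - u * d =
     ((S k).[z + u] - (S k).[z] - u * (S k)^`().[z]) +
     (((S k).[z] - h z) + u * ((S k)^`().[z] - d)) -
     ((S k).[z + u] - h (z + u)).
    by rewrite mulrBr; ring.
  apply: le_trans (le_normcB _ _) _.
  have := le_normcD ((S k).[z + u] - (S k).[z] - u * (S k)^`().[z])
    (((S k).[z] - h z) + u * ((S k)^`().[z] - d)).
  have := le_normcD ((S k).[z] - h z) (u * ((S k)^`().[z] - d)).
  rewrite Normc.normcM.
  have h7 : normc u * normc ((S k)^`().[z] - d) <= 1 * (4 * 2^-1 ^+ k).
    by apply: ler_pM; rewrite ?normc_ge0.
  by lra.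
- by apply: eqh; exists 0%N.
- by apply: eqh; exact: ST.
Qed.

Corollary entire_vanishing_at (T : set R[i]) (c : C) : locally_finite T -> ~ T c ->
  exists h : C -> C, [/\ (forall z, differentiable (h : C^o -> C^o) z),
    h c = 1 & forall t, T t -> h t = 0].
Proof.
move=> lfT Tc; have [||h [dh h0 hT]] := @entire_vanishing [set t | T (c + t)].
- move=> r; apply: sub_finite_set
    (finite_image (fun t : C => t - c) (lfT (normc c + r))).
  move=> t [Tt tr]; exists (c + t); last by rewrite addrC addKr.
  by split => //=; apply: le_trans (le_normcD _ _) _; rewrite lerD2l.
- by rewrite /= addr0.
exists (fun z => h (z - c)); split=> [z||t Tt].
- apply: (@differentiable_comp _ _ _ _ (fun z : C^o => z - c : C^o) (h : C^o -> C^o)).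
    by apply: differentiableB; [exact: differentiable_id|exact: differentiable_cst].
  exact: dh.
- by rewrite subrr.
- by apply: hT; rewrite /= addrCA subrr addr0.
Qed.

Lemma bounded_finite_countable (U : Type) (E : set U) (f : U -> C) :
  (forall r : R, finite_set (E `&` [set x | normc (f x) <= r])) -> countable E.
Proof.
move=> fE; apply: (@sub_countable _ _ _
    (\bigcup_k (E `&` [set x | normc (f x) <= k%:R]))).
  apply: subset_card_le => z Ez.
  by have [k zk] := exists_natr_ge (normc (f z)); exists k.
by apply: bigcup_countable => // k _; exact: finite_set_countable.
Qed.

End entire_functions.

(** * Discrete sets and compact sets *)

Section discrete_sets.

(** If [D `&` K] were infinite, the sets that contain all but finitely many of
its points would form a proper filter, with a cluster point in [K] by
compactness; this point would lie in [D] and be a limit of other points of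
[D]. *)
Lemma discrete_compact_finite (T : topologicalType) (D K : set T) :
  closed D -> D `<=` isolated D -> compact K -> finite_set (D `&` K).
Proof.
move=> cD iD cK; apply: contrapT => infD; set A := D `&` K in infD *.
pose F : set_system T := [set B | finite_set (A `\` B)].
have PF : ProperFilter F.
  split; first by rewrite /F /= setD0.
  split=> [|B B' FB FB'|B B' BB']; rewrite /F /=.
  - by rewrite setDT; exact: finite_set0.
  - by rewrite setDIr finite_setU.
  - by apply: sub_finite_set; exact: setDS.
have FA : F A by rewrite /F /= setDv; exact: finite_set0.
have [|p [Kp pF]] := cK F PF.
  by apply: filterS FA => x [].
have Dp : D p.
  apply: cD => U Up; have [x [[Dx _] Ux]] := pF A U FA Up.
  by exists x.
have [_ [U Up UD]] := iD p Dp.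
have [|x [[[Dx Kx] xp] Ux]] := pF (A `\ p) U _ Up.
  rewrite /F /=; apply: sub_finite_set (finite_set1 p) => x [Ax nx].
  by apply: contrapT => xp; apply: nx.
by apply: xp; have : (U `&` D) x by []; rewrite UD.
Qed.

End discrete_sets.

Section complex_topology.
Variable R : realType.
Local Notation C := (Cfield R).

Lemma real_complex_continuous : continuous (fun x : R => x%:C : C).
Proof.
move=> x; apply/cvgrPdist_le => e e0.
have [d d0 de] := gt0_real_complex e0.
near=> y; rewrite de -rmorphB normE lecR /= expr0n addr0 sqrtr_sqr.
by near: y; apply: cvgr_dist_le d0; exact: cvg_id.
Unshelve. all: by end_near.
Qed.

(** Closed discs of C are contained in squares, whose compactness comes from
that of real segments. *)
Definition square (r : R) : set C :=
  (fun x : R * R => x.1%:C + 'i * x.2%:C : C) @` (`[-r, r] `*` `[-r, r]).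

Lemma square_compact r : compact (square r).
Proof.
apply: continuous_compact; last first.
  by apply: compact_setX; exact: segment_compact.
apply: continuous_subspaceT => x.
have c1 : {for x, continuous (fun x : R * R => x.1%:C : C^o)}.
  apply: (@continuous_comp _ _ _ fst (fun x : R => x%:C : C)); first exact: cvg_fst.
  exact: real_complex_continuous.
have c2 : {for x, continuous (fun x : R * R => x.2%:C : C^o)}.
  apply: (@continuous_comp _ _ _ snd (fun x : R => x%:C : C)); first exact: cvg_snd.
  exact: real_complex_continuous.
exact: (continuousD c1 (continuousM (@cst_continuous _ _ ('i : C) x) c2)).
Qed.

Lemma disc_square r (z : C) : normc z <= r -> square r z.
Proof.
move=> zr; exists (complex.Re z, complex.Im z); last by rewrite /= -complexE.
by split; rewrite /= in_itv /= -ler_norml (le_trans _ zr)// ?Re_le_normc ?Im_le_normc.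
Qed.

Definition box n r : set 'rV[C]_n := [set v | forall j, square r (v 0 j)].

Lemma box_compact n r : compact (@box n r).
Proof. by apply: (@rV_compact C n (fun=> square r)) => i; exact: square_compact. Qed.

(** The real parts of a countable set are countable, so they do not fill the unit
interval, which has positive Lebesgue measure. *)
Lemma countable_complex_proper (A : set C) : countable A -> exists c, ~ A c.
Proof.
move=> cA; apply: contrapT => /forallNP nA.
have : countable (`[0, 1]%classic : set R).
  apply: (@sub_countable _ _ _ ((fun z : C => complex.Re z) @` A)).
    apply: subset_card_le => x _; exists x%:C => //.
    by apply: contrapT; exact: nA.
  exact: (card_le_trans (card_image_le _ _)).
move=> /countable_lebesgue_measure0; rewrite lebesgue_measure_itv/= lte_fin ltr01.
by rewrite oppr0 adde0 => /eqP; rewrite eqe oner_eq0.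
Qed.

End complex_topology.

(** * Differentials of maps into row vectors *)

Section calculus.
Variable R : realType.
Local Notation C := (Cfield R).

Lemma is_diff_coord n (x : 'rV[C]_n) j :
  is_diff x (fun y => y 0 j : C^o) (fun v => v 0 j).
Proof.
have @c : {linear 'rV[C]_n -> C^o}.
  by exists (fun N : 'rV[C]_n => N 0 j); do 2![eexists]; do ?[constructor];
     rewrite ?mxE// => ? *; rewrite ?mxE//; move=> ?; rewrite !mxE.
have cc : continuous c by exact: coord_continuous.
apply: DiffDef; first exact: differentiable_coord.
by rewrite -[fun y => _]/(c : _ -> _); exact: (diff_lin x cc).
Qed.

Lemma is_diff_rV (V : normedModType C) n (f L : V -> 'rV[C]_n) (x : V) :
  (forall j, is_diff x (fun y => f y 0 j : C^o) (fun v => L v 0 j)) ->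
  is_diff x f L.
Proof.
move=> fL; have df : differentiable f x.
  by apply: differentiable_rV => j; exact: ex_diff.
apply: DiffDef => //; apply/funext => v; apply/rowP => j.
have [_ /(congr1 (@^~ v)) <-] := fL j.
have [_ /(congr1 (@^~ v))] := is_diff_comp (differentiableP df) (is_diff_coord (f x) j).
by move=> ->.
Qed.

Lemma jacobian_is_diff m n (f : 'rV[C]_m -> 'rV[C]_n) x (A : 'M[C]_(m, n)) :
  is_diff x f (mulmxr A) -> 'J f x = A.
Proof.
move=> fA; apply/row_matrixP => i; rewrite !rowE -deriveEjacobian ?deriveE//.
by rewrite diff_val.
Qed.

End calculus.

(** * Holomorphic maps between manifolds *)

Section holomorphic_maps.
Variable R : realType.
Local Notation C := (Cfield R).

Lemma near_cdom n (M : complexManifold R n) (phi : chart R M n) p :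
  cdom phi p -> nbhs p (cdom phi).
Proof. by move=> php; apply: open_nbhs_nbhs; split => //; exact: cdom_open. Qed.

Lemma near_chart_inv n (M : complexManifold R n) (phi : chart R M n) p (A : set M) :
  cdom phi p -> nbhs p A -> \forall v \near cmap phi p, A (cinv phi v).
Proof. by move=> php Ap; apply: cinv_continuous => //; rewrite cmapK. Qed.

(** The chain rule in charts. Near the base point, continuity of [f] lets one
insert a chart of the middle manifold between the two local expressions. *)
Lemma cdifferentiable_comp k m n (L : complexManifold R k) (M : complexManifold R m)
    (N : complexManifold R n) (f : L -> M) (g : M -> N) p :
  cdifferentiable_at f p -> cdifferentiable_at g (f p) ->
  cdifferentiable_at (g \o f) p.
Proof.
move=> [cf df] [cg dg]; split; first exact: continuous_comp.
move=> phi psi aphi apsi php psp; have [chi achi chp] := atlas_cover (f p).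
apply: (@near_eq_differentiable _ _ _ (local_expr chi psi g \o local_expr phi chi f)).
  have : \forall v \near cmap phi p, cdom chi (f (cinv phi v)).
    by apply: (@near_chart_inv _ _ phi p (f @^-1` cdom chi) php); apply: cf; exact: near_cdom.
  by apply: filterS => v cv; rewrite /local_expr /= cmapK.
apply: differentiable_comp; first exact: df.
by rewrite /local_expr /= cmapK//; exact: dg.
Qed.

Lemma cdifferentiable_val n m (M : complexManifold R n) (U : set M) (oU : open U)
    (L : complexManifold R m) (f : L -> open_submanifold oU) p :
  cdifferentiable_at (val \o f : L -> M) p -> cdifferentiable_at f p.
Proof.
move=> [cf df]; split.
  move=> A [/= B [[W oW <-] /= Wp] BA]; rewrite /= nbhs_filterE.
  have : \forall q \near p, W (val (f q)).
    by apply: cf; apply: open_nbhs_nbhs; split.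
  by apply: filterS => q Wq; exact: BA.
by move=> phi _ aphi [psi apsi [q0 _ <-]] php psp; exact: df.
Qed.

Lemma cdifferentiable_cinv n (M : complexManifold R n) (phi : chart R M n) p :
  atlas phi -> cdom phi p ->
  cdifferentiable_at (cinv phi : affine_space R n -> M) (cmap phi p).
Proof.
move=> aphi php; split; first exact: cinv_continuous.
move=> _ psi -> apsi _ psp; apply: atlas_holomorphic => //.
by move: psp; rewrite cmapK.
Qed.

Lemma cdifferentiable_affine m n (f : affine_space R m -> affine_space R n)
    (v : 'rV[C]_m) :
  differentiable (f : 'rV[C]_m -> 'rV[C]_n) v -> cdifferentiable_at f v.
Proof.
move=> df; split; first exact: differentiable_continuous.
by move=> _ _ -> -> _ _.
Qed.

Lemma cdifferentiable_near_eq m n (M : complexManifold R m) (N : complexManifold R n)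
    (f g : M -> N) p :
  {near p, f =1 g} -> cdifferentiable_at f p -> cdifferentiable_at g p.
Proof.
move=> fg [cf df]; have fgp : f p = g p by exact: nbhs_singleton fg.
split.
  move=> A; rewrite -fgp => /cf fA; rewrite /= nbhs_filterE.
  by apply: filterS2 fg fA => q /= ->.
move=> phi psi aphi apsi php; rewrite -fgp => psp.
apply: near_eq_differentiable (df _ _ aphi apsi php psp).
have := near_chart_inv php fg.
by apply: filterS => v; rewrite /local_expr /= => ->.
Qed.

Lemma cdifferentiable_cmap n (M : complexManifold R n) (phi : chart R M n) p :
  atlas phi -> cdom phi p ->
  cdifferentiable_at (cmap phi : M -> affine_space R n) p.
Proof.
move=> aphi php; split; first exact: cmap_continuous.
by move=> chi _ achi -> chp _; exact: atlas_holomorphic.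
Qed.

(** One chart at the source is enough to test complex differentiability, because
[cmap phi] is itself holomorphic. *)
Lemma cdifferentiable_chart m n (M : complexManifold R m) (N : complexManifold R n)
    (phi : chart R M m) (f : M -> N) p :
  atlas phi -> cdom phi p ->
  cdifferentiable_at (f \o cinv phi : affine_space R m -> N) (cmap phi p) ->
  cdifferentiable_at f p.
Proof.
move=> aphi php df.
have := cdifferentiable_comp (cdifferentiable_cmap aphi php) df.
apply: cdifferentiable_near_eq; apply: filterS (near_cdom php) => q phq.
by rewrite /= cmapK.
Qed.

Lemma cdifferentiable_fst m n (M : complexManifold R m) (N : complexManifold R n)
    (p : prod_manifold M N) :
  cdifferentiable_at (fst : prod_manifold M N -> M) p.
Proof.
case: p => p q; split; first exact: cvg_fst.
move=> _ chi [phi aphi [psi apsi <-]] achi [/= php psq] chp.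
have -> : local_expr (M := prod_manifold M N) (N := M) (prod_chart phi psi) chi fst =
    (cmap chi \o cinv phi) \o lsubmx by [].
apply: differentiable_comp; first exact: differentiable_lsubmx.
by rewrite /= /prod_cmap row_mxKl; exact: atlas_holomorphic.
Qed.

Lemma cdifferentiable_pair l m n (L : complexManifold R l) (M : complexManifold R m)
    (N : complexManifold R n) (f : L -> M) (g : L -> N) p :
  cdifferentiable_at f p -> cdifferentiable_at g p ->
  cdifferentiable_at ((fun q => (f q, g q)) : L -> prod_manifold M N) p.
Proof.
move=> [cf df] [cg dg]; split; first exact: cvg_pair.
move=> chi _ achi [phi aphi [psi apsi <-]] chp [/= php psq].
apply: differentiable_rV => j; case: (split_ordP j) => k ->.
  rewrite (_ : (fun y => _) = (fun v : 'rV[C]_m => v 0 k : C^o) \o local_expr chi phi f).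
    by apply: differentiable_comp; [exact: df|exact: differentiable_coord].
  by apply/funext => y; rewrite /local_expr /= /prod_cmap row_mxEl.
rewrite (_ : (fun y => _) = (fun v : 'rV[C]_n => v 0 k : C^o) \o local_expr chi psi g).
  by apply: differentiable_comp; [exact: dg|exact: differentiable_coord].
by apply/funext => y; rewrite /local_expr /= /prod_cmap row_mxEr.
Qed.

End holomorphic_maps.

(** * Charts of projective space *)

Section projective_charts.
Variables (R : realType) (n : nat).
Local Notation C := (Cfield R).

Lemma proj_cmapK (i : 'I_n.+1) (z : 'rV[C]_n) : proj_cmap i (proj_cinv i z) = z.
Proof.
by rewrite /proj_cinv /proj_point proj_cmapE; apply/rowP => j;
  rewrite mxE /= homog_i homog_lift divr1.
Qed.

Lemma proj_cdom_cinv (i k : 'I_n.+1) (z : 'rV[C]_n) :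
  proj_cdom k (proj_cinv i z) <-> homog i z 0 k != 0.
Proof. exact: proj_cdomE. Qed.

Lemma cdifferentiable_proj_cinv k (z : 'rV[C]_n) :
  cdifferentiable_at (proj_cinv k : affine_space R n -> projective_space R n) z.
Proof.
have := @cdifferentiable_cinv R n (projective_space R n) (proj_chart R k)
  (proj_cinv k z).
rewrite /= proj_cmapK; apply; first by exists k.
by apply/proj_cdom_cinv; rewrite homog_i oner_neq0.
Qed.

(** Holomorphic maps into projective space may be given by nowhere vanishing
homogeneous coordinates: near a point where the k-th one is nonzero, the map is
the k-th parametrization applied to their quotients. *)
Lemma cdifferentiable_proj_point m (L : 'rV[C]_m -> 'rV[C]_n.+1)
    (L0 : forall v, L v != 0) v :
  (forall w, differentiable L w) ->
  cdifferentiable_at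
    ((fun w => proj_point (L0 w)) : affine_space R m -> projective_space R n) v.
Proof.
move=> dL; have /rV0Pn[k Lk] := L0 v.
have dLj j w : differentiable (fun w => L w 0 j : C^o) w.
  apply: (@differentiable_comp _ _ _ _ L (fun u => u 0 j : C^o)) => //.
  exact: differentiable_coord.
have nk : \forall w \near v, L w 0 k != 0.
  apply: neq0_near Lk; exact: (differentiable_continuous (dLj k v)).
pose q (w : affine_space R m) : affine_space R n := \row_j (L w 0 (lift k j) / L w 0 k).
have qE w : L w 0 k != 0 -> proj_cinv k (q w) = proj_point (L0 w).
  move=> Lwk; have cw : proj_cdom k (proj_point (L0 w)) by exact/proj_cdomE.
  rewrite -[RHS](@cmapK _ _ _ (proj_chart R k) _ cw) /=.
  by rewrite [X in _ = proj_cinv k X]proj_cmapE.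
apply: (@cdifferentiable_near_eq R m n (affine_space R m) (projective_space R n)
    (proj_cinv k \o q)).
  by apply: filterS nk => w; exact: qE.
apply: cdifferentiable_comp.
  apply: cdifferentiable_affine; apply: differentiable_rV => j.
  rewrite (_ : (fun y => _) = (fun y => L y 0 (lift k j) : C^o) *
      (fun y => (L y 0 k)^-1 : C^o)); last by apply/funext => y; rewrite mxE.
  by apply: differentiableM => //; apply: differentiableV.
exact: cdifferentiable_proj_cinv.
Qed.

Lemma nonzero_repr (p : projective_space R n) :
  val (repr (p : projective_points R n)) != 0.
Proof. by case: (repr _) => v /= /set_mem. Qed.

Lemma proj_pointP (u v : 'rV[C]_n.+1) (u0 : u != 0) (v0 : v != 0) (c : C) :
  c != 0 -> u = c *: v -> proj_point u0 = proj_point v0.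
Proof. by move=> c0 uv; apply/eqmodP/asboolP; exists c. Qed.

Lemma proj_point_repr (p : projective_space R n)
    (v0 : val (repr (p : projective_points R n)) != 0) :
  proj_point v0 = p.
Proof.
rewrite -[RHS](@reprK _ (projective_points R n)); apply/eqmodP/asboolP.
by exists 1; rewrite ?oner_neq0 ?scale1r.
Qed.

(** Dividing by the largest homogeneous coordinate puts any point in the unit
polydisc of a chart; this is the compactness of projective space. *)
Lemma projective_cover (p : projective_space R n) :
  exists k : 'I_n.+1, (proj_cinv k @` box 1) p.
Proof.
pose v := val (repr (p : projective_points R n)).
have [k _ kmax] := @arg_maxP _ _ _ (ord0 : 'I_n.+1) xpredT (fun k => normc (v 0 k)) isT.
have vk0 : v 0 k != 0.
  have /rV0Pn[l vl] := nonzero_repr p.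
  by rewrite -normc_gt0 (lt_le_trans _ (kmax l isT))// normc_gt0.
exists k; exists (proj_cmap k p); last exact: (@cmapK _ _ _ (proj_chart R k) p).
move=> j; apply: disc_square.
rewrite mxE Normc.normcM Normc.normcV ler_pdivrMr ?normc_gt0// mul1r.
exact: kmax.
Qed.

End projective_charts.

(** * Maps from affine space to the complement of a discrete set *)

Section punctured_charts.
Variables (R : realType) (n : nat).
Local Notation C := (Cfield R).
Local Notation X := (punctured_projective_space R n).

Lemma proj_cinv_punctured k (z : 'rV[C]_n) :
  (~` [set base_point R n]) (proj_cinv (lift ord0 k) z).
Proof.
move=> /= E.
have : proj_cdom (lift ord0 k) (proj_cinv (lift ord0 k) z).
  by apply/proj_cdom_cinv; rewrite homog_i oner_neq0.
rewrite E => /proj_cdomE.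
by rewrite /= mxE -[lift _ _ == _]/false andbF eqxx.
Qed.

(** The parametrizations other than the zeroth miss the base point, hence are
defined on all of affine space; together they cover the punctured space. *)
Definition punctured_cinv k (z : 'rV[C]_n) : X :=
  exist _ (proj_cinv (lift ord0 k) z) (mem_set (@proj_cinv_punctured k z)).

Lemma punctured_cinv_cdifferentiable k (z : 'rV[C]_n) :
  cdifferentiable_at (punctured_cinv k : affine_space R n -> X) z.
Proof.
by apply: cdifferentiable_val; exact: cdifferentiable_proj_cinv.
Qed.

End punctured_charts.

Section discrete_in_chart.
Variables (R : realType) (m : nat).
Local Notation C := (Cfield R).
Local Notation X := (punctured_projective_space R m.+1).

(** Renormalizing by the largest of the homogeneous coordinates other than the
zeroth keeps the zeroth bounded. *)
Lemma punctured_cinv_box (z : 'rV[C]_m.+1) (r : R) : 1 <= r ->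
  normc (z 0 0) <= r ->
  exists k, (punctured_cinv k @` box r) (punctured_cinv ord0 z).
Proof.
move=> r1 zr; pose o1 : 'I_m.+2 := lift ord0 ord0.
pose v := homog o1 z.
have [k _ kmax] := @arg_maxP _ _ _ (ord0 : 'I_m.+1) xpredT
  (fun k => normc (v 0 (lift ord0 k))) isT.
have vk1 : 1 <= normc (v 0 (lift ord0 k)).
  by have := kmax ord0 isT; rewrite /v homog_i Normc.normc1.
have vk0 : v 0 (lift ord0 k) != 0.
  by rewrite -normc_gt0 (lt_le_trans ltr01).
have pk : proj_cdom (lift ord0 k) (proj_cinv o1 z) by exact/proj_cdom_cinv.
exists k; exists (proj_cmap (lift ord0 k) (proj_cinv o1 z)); last first.
  by apply: val_inj; exact: (@cmapK _ _ _ (proj_chart R (lift ord0 k)) _ pk).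
move=> j; apply: disc_square.
rewrite /proj_cinv /proj_point proj_cmapE mxE /= -/v.
rewrite Normc.normcM Normc.normcV ler_pdivrMr ?(lt_le_trans ltr01 vk1)//.
case: (unliftP ord0 (lift (lift ord0 k) j)) => [l|] ->.
  apply: le_trans (kmax l isT) _.
  by rewrite ler_peMl// (le_trans ler01 vk1).
have -> : v 0 ord0 = z 0 0.
  rewrite /v -[in RHS](homog_lift o1); congr (homog _ _ _ _); exact: val_inj.
by apply: le_trans zr _; rewrite ler_peMr// (le_trans ler01 r1).
Qed.

(** The first coordinate of this chart is z_0 / z_1. The bound on it confines
the point to the compact images of boxes under the [punctured_cinv k], which
meet [D] in finite sets. *)
Lemma discrete_in_chart (D : set X) : closed D -> D `<=` isolated D ->
  forall r : R, finite_set ((punctured_cinv ord0 @^-1` D) `&`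
    [set z : 'rV[C]_m.+1 | normc (z 0 0) <= r]).
Proof.
move=> cD iD r; set r' := Num.max 1 r.
pose K k : set X := punctured_cinv k @` @box R m.+1 r'.
have cK k : compact (K k).
  apply: continuous_compact; last exact: box_compact.
  apply: continuous_subspaceT => z.
  by have [] := @punctured_cinv_cdifferentiable R m.+1 k z.
have fK : finite_set (\bigcup_(k in [set: 'I_m.+1]) (D `&` K k)).
  by apply: bigcup_finite => // k _; exact: discrete_compact_finite.
apply: sub_finite_set (finite_image
  (fun p : X => proj_cmap (lift ord0 ord0) (val p) : 'rV[C]_m.+1) fK).
move=> z [Dz zr]; exists (punctured_cinv ord0 z); last exact: proj_cmapK.
have [||k Kk] := @punctured_cinv_box z r'.
- by rewrite le_max lexx.
- by rewrite le_max [normc _ <= r]zr orbT.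
by exists k.
Qed.

End discrete_in_chart.

Section avoiding_map.
Variable R : realType.
Local Notation C := (Cfield R).

(** The map is (c + s_0, c + h(c + s_0) s_1, s_2, ...), where c is different from
all coordinates of points of E and h vanishes on the first coordinates of points
of E, with h(c) = 1. Above a zero of h the second coordinate is c, and elsewhere
the first coordinate is not that of a point of E. *)
Lemma avoiding_map m (E : set 'rV[C]_m.+2) :
  (forall r : R, finite_set (E `&` [set z | normc (z 0 0) <= r])) ->
  exists g : 'rV[C]_m.+2 -> 'rV[C]_m.+2, [/\ (forall s, differentiable g s),
    is_diff 0 g id & forall s, ~ E (g s)].
Proof.
move=> fE; pose o1 : 'I_m.+2 := lift ord0 ord0.
have cE : countable E by exact: (bounded_finite_countable fE).
have [c cE'] : exists c : C, forall z j, E z -> z 0 j <> c.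
  have [|c nc] := @countable_complex_proper R
      (\bigcup_(j in [set: 'I_m.+2]) (fun z => z 0 j) @` E).
    apply: bigcup_countable => [|j _]; first exact: finite_set_countable.
    exact: (card_le_trans (card_image_le _ _)).
  by exists c => z j Ez zc; apply: nc; exists j => //; exists z.
have [||h [dh h0 hT]] := @entire_vanishing_at R ((fun z : 'rV[C]_m.+2 => z 0 0 : C) @` E) c.
- move=> r; apply: sub_finite_set (finite_image (fun z : 'rV[C]_m.+2 => z 0 0 : C) (fE r)).
  by move=> _ [[z Ez <-] zr]; exists z.
- by move=> [z Ez]; exact: cE'.
pose g (s : 'rV[C]_m.+2) : 'rV[C]_m.+2 := \row_j
  (if j == 0 then c + s 0 0 else if j == o1 then c + h (c + s 0 0) * s 0 o1 else s 0 j).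
have g0E : (fun s => g s 0 0 : C^o) = cst c + (fun s => s 0 0).
  by apply/funext => s; rewrite mxE eqxx.
have g1E : (fun s => g s 0 o1 : C^o) =
    cst c + (fun s => h (c + s 0 0) : C^o) * (fun s => s 0 o1).
  by apply/funext => s; rewrite mxE eqxx.
have gjE j : j != 0 -> j != o1 -> (fun s => g s 0 j : C^o) = (fun s => s 0 j).
  by move=> j0 j1; apply/funext => s; rewrite mxE (negPf j0) (negPf j1).
have dhc (s : 'rV[C]_m.+2) : differentiable (fun s : 'rV[C]_m.+2 => h (c + s 0 0) : C^o) s.
  apply: (@differentiable_comp _ _ _ _ (fun s : 'rV[C]_m.+2 => c + s 0 0 : C^o) (h : C^o -> C^o)).
    apply: differentiableD; first exact: differentiable_cst.
    exact: differentiable_coord.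
  exact: dh.
exists g; split.
- move=> s; apply: differentiable_rV => j.
  have [->|j0] := eqVneq j 0.
    rewrite g0E; apply: differentiableD; first exact: differentiable_cst.
    exact: differentiable_coord.
  have [->|j1] := eqVneq j o1; last by rewrite gjE//; exact: differentiable_coord.
  rewrite g1E; apply: differentiableD; first exact: differentiable_cst.
  by apply: differentiableM => //; exact: differentiable_coord.
- apply: is_diff_rV => j.
  have [->|j0] := eqVneq j 0.
    rewrite g0E; have := is_diffD (is_diff_cst (c : C^o) 0) (is_diff_coord (0 : 'rV[C]_m.+2) 0).
    by rewrite add0r.
  have [->|j1] := eqVneq j o1; last by rewrite gjE//; exact: is_diff_coord.
  rewrite g1E; have := is_diffD (is_diff_cst (c : C^o) 0)
    (is_diffM (differentiableP (dhc 0)) (is_diff_coord (0 : 'rV[C]_m.+2) o1)).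
  by rewrite add0r !mxE addr0 h0 scale1r scale0r addr0.
- move=> s Eg; apply: (cE' _ o1 Eg).
  rewrite mxE eqxx /= hT ?mul0r ?addr0//.
  by exists (g s) => //; rewrite mxE eqxx.
Qed.

End avoiding_map.

Section dominating_map.
Variable R : realType.
Local Notation C := (Cfield R).
Variable m : nat.
Local Notation n := m.+2.
Variables (D : set (punctured_projective_space R n)) (cD : closed D).
Local Notation Y := (open_submanifold (closed_openC cD)).

(** Since the map takes its values in a single chart, its properties are those
of its coordinate expression, the map of [avoiding_map]. *)
Lemma dominating_map : D `<=` isolated D ->
  exists (G : affine_space R n -> Y) (psi : chart R Y n),
    [/\ holomorphic G, atlas psi, (forall s, cdom psi (G s)) &
        is_diff (0 : 'rV[C]_n) (cmap psi \o G : 'rV[C]_n -> 'rV[C]_n) id].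
Proof.
move=> iD; have [g [dg g0 gE]] := avoiding_map (discrete_in_chart cD iD).
pose G (s : affine_space R n) : Y :=
  exist _ (punctured_cinv ord0 (g s)) (mem_set (gE s)).
pose psi := sub_chart (closed_openC cD)
  (sub_chart (@base_pointC_open R n) (proj_chart R (lift ord0 ord0))
  (punctured_cinv ord0 0)) (G (0 : 'rV[C]_n)).
have psiG : cmap psi \o G = g by apply/funext => s; exact: proj_cmapK.
exists G, psi; rewrite psiG; split => //.
- move=> s _; apply: cdifferentiable_val.
  apply: (@cdifferentiable_comp R n n n (affine_space R n) (affine_space R n)
    (punctured_projective_space R n) g (punctured_cinv ord0)).
    exact: cdifferentiable_affine.
  exact: punctured_cinv_cdifferentiable.
- eexists; last by exists (G (0 : 'rV[C]_n)).
  eexists; last by exists (punctured_cinv ord0 0).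
  by exists (lift ord0 ord0).
- by move=> s; apply/proj_cdom_cinv; rewrite homog_i oner_neq0.
Qed.

End dominating_map.

(** * Consequences of a map from affine space with invertible differential *)

Section dominated_manifolds.
Variable R : realType.
Local Notation C := (Cfield R).

(** A map to affine space of maximal rank at p is translated so that p goes to
0, where the differential of [G] is the identity. *)
Lemma dominated_nondegenerate n (V Y : complexManifold R n) (G : affine_space R n -> Y)
    (psi : chart R Y n) :
  Stein V -> [set: V] !=set0 ->
  holomorphic G -> atlas psi -> (forall s, cdom psi (G s)) ->
  is_diff (0 : 'rV[C]_n) (cmap psi \o G : 'rV[C]_n -> 'rV[C]_n) id ->
  exists F : V -> Y, holomorphic F /\ nondegenerate_map F.
Proof.
move=> SV [p _] hG apsi psiG G0.
have [g hg [phi [_ [aphi -> php _ rk]]]] := stein_coordinates SV p.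
pose tr (v : affine_space R n) : affine_space R n := (v : 'rV[C]_n) - g p.
have dtr (v : 'rV[C]_n) : is_diff v (tr : 'rV[C]_n -> 'rV[C]_n) id.
  have := is_diffB (is_diff_id v) (is_diff_cst (g p : 'rV[C]_n) v).
  by rewrite subr0.
exists (G \o (tr \o g)); split.
  move=> q _; apply: cdifferentiable_comp; last exact: hG.
  apply: cdifferentiable_comp; first exact: hg.
  by apply: cdifferentiable_affine; have [] := dtr (g q).
exists p, phi, psi; split; [exact: aphi|exact: apsi|exact: php|exact: psiG|].
pose loc : 'rV[C]_n -> 'rV[C]_n := @local_expr R n n V (affine_space R n) phi (id_chart R n) g.
have dloc : differentiable loc (cmap phi p).
  by have [_ dg] := hg p I; exact: (dg phi (id_chart R n)).
have locp : loc (cmap phi p) = g p by rewrite /loc /local_expr /= cmapK.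
have dtl : is_diff (cmap phi p) (tr \o loc) ('d loc (cmap phi p)).
  exact: (is_diff_comp (differentiableP dloc) (dtr _)).
have G0' : is_diff ((tr \o loc) (cmap phi p))
    (cmap psi \o G : 'rV[C]_n -> 'rV[C]_n) id.
  by rewrite /= locp /tr subrr.
have JE : 'J (local_expr phi psi (G \o (tr \o g))) (cmap phi p) =
    'J loc (cmap phi p).
  have [_ E] := is_diff_comp dtl G0'.
  exact: (congr1 (@lin1_mx _ _ _) E).
by rewrite JE.
Qed.

(** Precomposing [G] with the dilation by k multiplies the determinant at 0 by
a positive power of k, so the infimum that defines the pseudovolume at G(0)
is 0. *)
Lemma dominated_not_measure_hyperbolic n (Y : complexManifold R n.+1)
    (G : affine_space R n.+1 -> Y) (psi : chart R Y n.+1) :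
  holomorphic G -> atlas psi -> (forall s, cdom psi (G s)) ->
  is_diff (0 : 'rV[C]_n.+1) (cmap psi \o G : 'rV[C]_n.+1 -> 'rV[C]_n.+1) id ->
  ~ measure_hyperbolic Y.
Proof.
move=> hG apsi psiG G0; pose p := G (0 : 'rV[C]_n.+1).
move=> /(_ p psi apsi (psiG _)).
apply/negP; rewrite -leNgt.
have bound k : (pseudovolume psi p <= (k.+1%:R ^- 1)%:E)%E.
  pose sc (v : affine_space R n.+1) : affine_space R n.+1 :=
    (k.+1%:R : C) *: (v : 'rV[C]_n.+1).
  have dsc (v : 'rV[C]_n.+1) :
      is_diff v (sc : 'rV[C]_n.+1 -> 'rV[C]_n.+1) (sc : 'rV[C]_n.+1 -> 'rV[C]_n.+1).
    exact: is_diff_scaler.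
  have sc0 : sc (0 : 'rV[C]_n.+1) = 0 by rewrite /sc scaler0.
  have J : 'J (cmap psi \o (G \o sc)) 0 = (k.+1%:R : C)%:M.
    apply: jacobian_is_diff.
    have -> : mulmxr (k.+1%:R : C)%:M = sc :> ('rV[C]_n.+1 -> 'rV[C]_n.+1).
      by apply/funext => v; rewrite /= mul_mx_scalar.
    have G0' : is_diff (sc (0 : 'rV[C]_n.+1))
        (cmap psi \o G : 'rV[C]_n.+1 -> 'rV[C]_n.+1) id by rewrite sc0.
    exact: (is_diff_comp (dsc 0) G0').
  apply: (@le_trans _ _ ((Normc.normc (\det ('J (cmap psi \o (G \o sc)) 0)) ^- 2)%R)%:E).
    apply: ereal_inf_lbound; exists (G \o sc) => //; split.
    - move=> s _; apply: cdifferentiable_comp; last exact: hG.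
      by apply: cdifferentiable_affine; have [] := dsc s.
    - by rewrite /= sc0.
    - by rewrite J unitmxE det_scalar unitfE expf_neq0// pnatr_eq0.
  rewrite J det_scalar normcX normc_nat lee_fin lef_pV2 ?posrE ?exprn_gt0//.
  by rewrite -exprM ler_eXnr// ler1n.
apply/lee_addgt0Pr => e e0; rewrite add0e.
have [k ke] : exists k, k.+1%:R ^- 1 <= e.
  have ei : 0 < e^-1 by rewrite invr_gt0.
  have [k ek] := exists_natr_ge e^-1; exists k.
  rewrite expr1 -[leRHS]invrK lef_pV2 ?posrE// (le_trans ek)// ler_nat.
  exact: leqnSn.
by apply: le_trans (bound k) _; rewrite lee_fin.
Qed.

End dominated_manifolds.

(** * Shears of the product of the line and the projective line *)

Section shear.
Variable R : realType.
Local Notation C := (Cfield R).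
Local Notation P1 := (projective_space R 1).
Local Notation X := (prod_manifold (complex_line R) P1).

Definition shear (a : C) (v : 'rV[C]_2) : 'rV[C]_2 :=
  v + (a * v 0 1) *: delta_mx 0 0.

Lemma shear1 a v : shear a v 0 1 = v 0 1.
Proof. by rewrite !mxE /= mulr0 addr0. Qed.

Lemma shearD a b v : shear a (shear b v) = shear (a + b) v.
Proof. by rewrite {1}/shear shear1 /shear -addrA -scalerDl -mulrDl (addrC b). Qed.

Lemma shear0 v : shear 0 v = v.
Proof. by rewrite /shear mul0r scale0r addr0. Qed.

Lemma shearZ a c v : shear a (c *: v) = c *: shear a v.
Proof. by rewrite /shear scalerDr scalerA mxE mulrCA. Qed.

Lemma shear_neq0 a v : v != 0 -> shear a v != 0.
Proof.
apply: contra_neq => sv0; rewrite -(shear0 v) -(addNr a) -shearD sv0.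
by rewrite /shear mxE mulr0 scale0r addr0.
Qed.

(** In homogeneous coordinates, [u : v] |-> [u + a v : v]. *)
Definition proj_shear (a : C) (p : P1) : P1 :=
  proj_point (shear_neq0 a (nonzero_repr p)).

Lemma proj_shearE a v (v0 : v != 0) :
  proj_shear a (proj_point v0) = proj_point (shear_neq0 a v0).
Proof.
have [c c0 cv] := repr_proj_point (exist _ v (mem_set v0)).
by apply: (@proj_pointP _ _ _ _ _ _ c) => //; rewrite cv shearZ.
Qed.

Lemma proj_shear0 p : proj_shear 0 p = p.
Proof.
rewrite -[RHS](proj_point_repr (nonzero_repr p)) /proj_shear.
apply: (@proj_pointP _ _ _ _ _ _ 1); first exact: oner_neq0.
by rewrite shear0 scale1r.
Qed.

Lemma proj_shearD a b p : proj_shear a (proj_shear b p) = proj_shear (a + b) p.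
Proof.
rewrite {2}/proj_shear proj_shearE.
apply: (@proj_pointP _ _ _ _ _ _ 1); first exact: oner_neq0.
by rewrite shearD scale1r.
Qed.

Definition fibre_shear (h : C -> C) (x : X) : X := (x.1, proj_shear (h x.1) x.2).

(** Applied to the homogeneous coordinates of the chart at the source, the shear
is polynomial in them and in h(t), and nowhere zero; this treats all charts of
the projective line, and the fixed point [1 : 0], uniformly. *)
Lemma fibre_shear_holomorphic (h : C -> C) :
  (forall z, differentiable (h : C^o -> C^o) z) -> holomorphic (fibre_shear h).
Proof.
move=> dh [t p] _; apply: cdifferentiable_pair; first exact: cdifferentiable_fst.
have [phi [i _ <-] php] := @atlas_cover _ _ P1 p.
pose chi : chart R X (1 + 1) :=
  @prod_chart R 1 1 (complex_line R) P1 (complex_line_chart R) (proj_chart R i).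
apply: (@cdifferentiable_chart R _ _ X P1 chi).
- by exists (complex_line_chart R) => //; exists (proj_chart R i) => //; exists i.
- by split.
pose L (v : 'rV[C]_(1 + 1)) := shear (h (lsubmx v 0 0)) (homog i (rsubmx v)).
have L0 v : L v != 0 by apply: shear_neq0; exact: homog_neq0.
rewrite (_ : _ \o _ = (fun v => proj_point (L0 v))); last first.
  apply/funext => v; rewrite /= /proj_cinv proj_shearE.
  apply: (@proj_pointP _ _ _ _ _ _ 1); first exact: oner_neq0.
  by rewrite scale1r.
apply: cdifferentiable_proj_point => v; apply: differentiable_rV => j.
have dl (l : 'I_1) : differentiable (fun v : 'rV[C]_(1 + 1) => lsubmx v 0 l : C^o) v.
  apply: (@differentiable_comp _ _ _ _ lsubmx (fun u => u 0 l : C^o)).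
    exact: differentiable_lsubmx.
  exact: differentiable_coord.
have dr (l : 'I_1) : differentiable (fun v : 'rV[C]_(1 + 1) => rsubmx v 0 l : C^o) v.
  apply: (@differentiable_comp _ _ _ _ rsubmx (fun u => u 0 l : C^o)).
    exact: differentiable_rsubmx.
  exact: differentiable_coord.
have dhl : differentiable (fun v : 'rV[C]_(1 + 1) => h (lsubmx v 0 0) : C^o) v.
  apply: (@differentiable_comp _ _ _ _ (fun v : 'rV[C]_(1 + 1) => lsubmx v 0 0 : C^o)
    (h : C^o -> C^o)); [exact: dl|exact: dh].
have dhom k : differentiable
    (fun v : 'rV[C]_(1 + 1) => homog i (rsubmx v) 0 k : C^o) v.
  case: (unliftP i k) => [l|] ->.
    by under eq_fun do rewrite homog_lift; exact: dr.
  by under eq_fun do rewrite homog_i; exact: differentiable_cst.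
have -> : (fun v => L v 0 j : C^o) = (fun v => homog i (rsubmx v) 0 j : C^o) +
    (fun v => h (lsubmx v 0 0) : C^o) * (fun v => homog i (rsubmx v) 0 1 : C^o) *
    cst ((delta_mx 0 0 : 'rV[C]_2) 0 j : C^o).
  by apply/funext => w; rewrite /L /shear mxE [X in _ + X = _]mxE.
exact: (differentiableD (dhom j)
  (differentiableM (differentiableM dhl (dhom 1)) (differentiable_cst _ _))).
Qed.

Lemma fibre_shear_automorphism (h : C -> C) :
  (forall z, differentiable (h : C^o -> C^o) z) -> automorphism (fibre_shear h).
Proof.
move=> dh; exists (fibre_shear (fun z => - h z)); split.
- by move=> [t p]; rewrite /fibre_shear /= proj_shearD addNr proj_shear0.
- by move=> [t p]; rewrite /fibre_shear /= proj_shearD subrr proj_shear0.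
- exact: fibre_shear_holomorphic.
- apply: fibre_shear_holomorphic => z.
  by apply: differentiableN; exact: dh.
Qed.

(** The projective line is compact, so the points of [D] above a disc lie in a
compact set. *)
Lemma discrete_projection (D : set X) : closed D -> D `<=` isolated D ->
  locally_finite ((fst : X -> C) @` D).
Proof.
move=> cD iD r.
pose K k : set X := square r `*` (proj_cinv k @` @box R 1 1).
have cK k : compact (K k).
  apply: compact_setX; first exact: square_compact.
  apply: continuous_compact; last exact: box_compact.
  apply: continuous_subspaceT => z.
  by have [] := @cdifferentiable_proj_cinv R 1 k z.
have fK : finite_set (\bigcup_(k in [set: 'I_2]) (D `&` K k)).
  by apply: bigcup_finite => // k _; exact: discrete_compact_finite.
apply: sub_finite_set (finite_image (fst : X -> C) fK).
move=> _ [[[t p] Dtp <-] /= tr]; exists (t, p) => //.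
have [k pk] := projective_cover p.
by exists k => //; split => //; split => //; exact: disc_square.
Qed.

Theorem discrete_fixing_automorphism (D : set X) : closed D -> D `<=` isolated D ->
  exists phi : X -> X, [/\ automorphism phi, exists x, phi x <> x &
    forall x, D x -> phi x = x].
Proof.
move=> cD iD; have lfT := discrete_projection cD iD.
have [c Tc] := countable_complex_proper (bounded_finite_countable lfT).
have [h [dh hc hT]] := entire_vanishing_at lfT Tc.
exists (fibre_shear h); split; first exact: fibre_shear_automorphism.
- pose e : 'rV[C]_2 := delta_mx 0 1.
  have e0 : e != 0.
    by apply/eqP => /rowP/(_ 1)/eqP; rewrite !mxE /= oner_eq0.
  exists (c, proj_point e0); rewrite /fibre_shear /= hc proj_shearE => -[E].
  have : proj_cdom 0 (proj_point (shear_neq0 1 e0)).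
    by apply/proj_cdomE; rewrite /= !mxE /= add0r !mulr1 oner_eq0.
  by rewrite E => /proj_cdomE; rewrite /= !mxE /= eqxx.
- move=> [t p] Dtp; rewrite /fibre_shear /= hT ?proj_shear0//.
  by exists (t, p).
Qed.

End shear.

Theorem proposition1 (R : realType) :
  (forall (n : nat) (V : complexManifold R n)
     (D : set (punctured_projective_space R n)) (D_closed : closed D),
     (1 < n)%N -> [set: V] !=set0 -> Stein V -> D `<=` isolated D ->
     (exists F : V -> open_submanifold (closed_openC D_closed),
        holomorphic F /\ nondegenerate_map F) /\
     ~ measure_hyperbolic (open_submanifold (closed_openC D_closed))) /\
  (forall D : set (prod_manifold (complex_line R) (projective_space R 1)),
     closed D -> D `<=` isolated D ->
     exists phi : prod_manifold (complex_line R) (projective_space R 1) ->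
                  prod_manifold (complex_line R) (projective_space R 1),
       [/\ automorphism phi, exists x, phi x <> x &
           forall x, D x -> phi x = x]).
Proof.
split; last exact: discrete_fixing_automorphism.
move=> [|[|m]]// V D cD _ V0 SV iD.
have [G [psi [hG apsi psiG G0]]] := dominating_map cD iD.
split; first exact: (dominated_nondegenerate SV V0 hG apsi psiG G0).
exact: (dominated_not_measure_hyperbolic hG apsi psiG G0).
Qed.
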